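(* Let $M$ be a (simply connected) hyperkähler manifold and $j\ge1$ an integer. A valence $(0,2j)$ Killing tensor $\mu_{A'_1\cdots A'_{2j}}$ on $M$ gives rise to a valence $(1,2j-1)$ tri-Hamiltonian Killing tensor; namely, the tensor $$X^{A}{}_{A'_2\cdots A'_{2j}}=-i\,\frac{2j}{2j+1}\,\nabla^{AA'_1}\mu_{A'_1A'_2\cdots A'_{2j}},$$ for which $\nabla^{A}{}_{A'}\mu_{A'_1\cdots A'_{2j}}=-i\,\varepsilon_{A'(A'_1}X^{A}{}_{A'_2\cdots A'_{2j})}$, is a valence $(1,2j-1)$ tri-Hamiltonian Killing tensor.
   Context: $M$ is a hyperkähler manifold of real dimension $4m$, with hyperkähler metric $g$, complex structures $I_1,I_2,I_3$ satisfying the imaginary quaternion algebra, and Kähler forms $\omega_k(X,Y)=g(X,I_kY)$. The complexified tangent bundle splits as $T_{\mathbb{C}}M=E\otimes H$ with $E$, $H$ complex vector bundles of ranks $2m$ and $2$ associated to the standard representations of $Sp(m)$ and $Sp(1)$; the Levi-Civita connection $\nabla$ preserves this splitting, and the curvature induced on $H$ vanishes. $E$-indices are $A,B,\dots$ ($2m$-valued) and $H$-indices $A',B',\dots$ (2-valued); tangent indices are traded for pairs $AA'$ via a vielbein. $E$ and $H$ carry covariantly constant symplectic forms $\varepsilon_{AB}$, $\varepsilon_{A'B'}$, with which indices are raised and lowered by the Penrose–Rindler conventions: $\xi_{B}=\xi^{A}\varepsilon_{AB}$, $\xi^{A}=\varepsilon^{AB}\xi_B$ (likewise for primed indices). Round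 brackets denote total symmetrization (with normalization $1/n!$) over the enclosed indices of the same type. One has $g_{AA',BB'}=\varepsilon_{AB}\varepsilon_{A'B'}$, $(I_k)^{AA'}{}_{BB'}=-i(\sigma_k)^{A'}{}_{B'}\delta^A{}_B$ with $\sigma_k$ the Pauli matrices, and, setting $\omega^{A'}{}_{B'}=\tfrac12(\sigma_k)^{A'}{}_{B'}\omega_k$ (sum over $k$), $(\omega_{C'D'})_{AA',BB'}=i\,\varepsilon_{A'(C'}\varepsilon_{D')B'}\varepsilon_{AB}$. A valence $(0,2j)$ Killing tensor is a totally symmetric section $\mu_{A'_1\cdots A'_{2j}}=\mu_{(A'_1\cdots A'_{2j})}$ of $S^{2j}H$ satisfying $\nabla_{A(A'}\mu_{A'_1\cdots A'_{2j})}=0$. A tensor $X^{A}{}_{A'_2\cdots A'_{2j}}$ (totally symmetric in its primed indices) is a valence $(1,2j-1)$ Killing tensor if $\nabla^{(A}{}_{(A'_1}X^{B)}{}_{A'_2\cdots A'_{2j})}=0$; it is a tri-Hamiltonian Killing tensor if in addition $(\omega_{A'B'})_{CC',A(A'_1}\nabla^{CC'}X^{A}{}_{A'_2\cdots A'_{2j})}=0$. *)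

(* Defs.v *)
From mathcomp Require Import all_boot all_order all_algebra perm.
From mathcomp Require Import complex.
From mathcomp Require Import boolp classical_sets reals set_interval.
From mathcomp Require Import topology normedtype derive.

Set Implicit Arguments.
Unset Strict Implicit.
Unset Printing Implicit Defensive.

Import Order.TTheory GRing.Theory Num.Theory.
Import numFieldNormedType.Exports.

Local Open Scope classical_set_scope.
Local Open Scope ring_scope.
Local Open Scope complex_scope.

(* The imaginary unit, written out because the notation for it is overloaded. *)
Definition imagu (R : realType) : R[i] := 0 +i* 1.

(** * Smooth functions on open subsets of R^n *)

Definition pd (R : realType) n (k : 'I_n) (f : 'rV[R]_n -> R)
    (x : 'rV[R]_n) : R := 'D_(delta_mx 0 k) f x.

Definition pdC (R : realType) n (k : 'I_n) (f : 'rV[R]_n -> R[i])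
    (x : 'rV[R]_n) : R[i] :=
  pd k (fun y => complex.Re (f y)) x +i* pd k (fun y => complex.Im (f y)) x.

Fixpoint Ck (R : realType) n (r : nat) (D : set 'rV[R]_n)
    (f : 'rV[R]_n -> R) : Prop :=
  if r is r'.+1 then
    (forall x, D x -> differentiable f x) /\ (forall k, Ck r' D (pd k f))
  else forall x, D x -> {for x, continuous f}.

(* Meaningful for open D only, which is the case in every use below. *)
Definition smooth (R : realType) n (D : set 'rV[R]_n)
  (f : 'rV[R]_n -> R) : Prop := forall r, Ck r D f.

Definition smoothC (R : realType) n (D : set 'rV[R]_n)
    (f : 'rV[R]_n -> R[i]) : Prop :=
  smooth D (fun x => complex.Re (f x)) /\ smooth D (fun x => complex.Im (f x)).

(** * Smooth manifolds *)

(* A chart is a homeomorphism from the open set [chart_dom a] onto an open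
   subset of R^n; the values of [chart_map a] outside [chart_dom a], and of
   [chart_inv a] outside its image, are irrelevant. *)
Record smooth_manifold (R : realType) (n : nat) := SmoothManifold {
  carrier :> topologicalType;
  manifold_hausdorff : hausdorff_space carrier;
  manifold_second_countable : @second_countable carrier;
  chart_index : Type;
  chart_dom : chart_index -> set carrier;
  chart_map : chart_index -> carrier -> 'rV[R]_n;
  chart_inv : chart_index -> 'rV[R]_n -> carrier;
  chart_cover : forall p : carrier, exists a, chart_dom a p;
  chart_dom_open : forall a, open (chart_dom a);
  chart_im_open : forall a, open (chart_map a @` chart_dom a);
  chart_mapK : forall a p, chart_dom a p -> chart_inv a (chart_map a p) = p;
  chart_map_continuous : forall a p, chart_dom a p ->
    {for p, continuous (chart_map a)};
  chart_inv_continuous : forall a x, (chart_map a @` chart_dom a) x ->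
    {for x, continuous (chart_inv a)};
  chart_smooth : forall a b (i : 'I_n),
    smooth [set x | (chart_map a @` chart_dom a) x /\
                    chart_dom b (chart_inv a x)]
           (fun x => chart_map b (chart_inv a x) 0 i)
}.

Definition chart_im (R : realType) n (M : smooth_manifold R n)
  (a : chart_index M) : set 'rV[R]_n := chart_map a @` chart_dom a.

Definition overlap (R : realType) n (M : smooth_manifold R n)
    (a b : chart_index M) : set 'rV[R]_n :=
  [set x | chart_im a x /\ chart_dom b (chart_inv a x)].

Definition transition (R : realType) n (M : smooth_manifold R n)
    (a b : chart_index M) (x : 'rV[R]_n) : 'rV[R]_n :=
  chart_map b (chart_inv a x).

Definition simply_connected (R : realType) (T : topologicalType) : Prop :=
  (forall p q : T, exists2 c : R -> T, {within `[0, 1], continuous c} &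
     c 0 = p /\ c 1 = q) /\
  (forall c : R -> T, {within `[0, 1], continuous c} -> c 0 = c 1 ->
     exists2 h : R * R -> T,
       {within [set st : R * R | (0 <= st.1 <= 1) && (0 <= st.2 <= 1)],
         continuous h} &
       forall s, 0 <= s <= 1 ->
         [/\ h (0, s) = c s, h (1, s) = c 0, h (s, 0) = c 0 &
             h (s, 1) = c 0]).

(** * Hyperkaehler structures *)

Definition christoffel (R : realType) n (G : 'rV[R]_n -> 'M[R]_n)
    (k i j : 'I_n) (x : 'rV[R]_n) : R :=
  2^-1 * \sum_l invmx (G x) k l *
    (pd i (fun y => G y j l) x + pd j (fun y => G y i l) x -
     pd l (fun y => G y i j) x).

(* [metric a] and [cplx a k] are the components of g and I_k in the chart a;
   (I_k v)^i is the sum over j of [cplx a k x i j] times v^j.  The index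
   k = 0, 1, 2 : 'I_3 stands for I_1, I_2, I_3.  Since the Jacobian ['J] acts
   on row vectors from the right, its transpose is the usual Jacobian matrix. *)
Record hyperkahler (R : realType) n (M : smooth_manifold R n) := Hyperkahler {
  metric : chart_index M -> 'rV[R]_n -> 'M[R]_n;
  cplx : chart_index M -> 'I_3 -> 'rV[R]_n -> 'M[R]_n;
  metric_smooth : forall a i j, smooth (chart_im a) (fun x => metric a x i j);
  cplx_smooth : forall a k i j, smooth (chart_im a) (fun x => cplx a k x i j);
  metric_transition : forall a b x, overlap a b x ->
    let J := 'J (transition a b) x in
    metric a x = J *m metric b (transition a b x) *m J^T;
  cplx_transition : forall a b k x, overlap a b x ->
    let J := 'J (transition a b) x in
    J^T *m cplx a k x = cplx b k (transition a b x) *m J^T;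
  metric_sym : forall a x, chart_im a x -> (metric a x)^T = metric a x;
  metric_pos : forall a x (v : 'rV[R]_n), chart_im a x -> v != 0 ->
    0 < (v *m metric a x *m v^T) 0 0;
  cplx_square : forall a k x, chart_im a x ->
    cplx a k x *m cplx a k x = - 1%:M;
  cplx_quaternion : forall a x, chart_im a x ->
    cplx a 0 x *m cplx a 1 x = cplx a 2 x;
  cplx_hermitian : forall a k x, chart_im a x ->
    (cplx a k x)^T *m metric a x *m cplx a k x = metric a x;
  (* nabla I_k = 0 for the Levi-Civita connection: g is Kaehler for each I_k *)
  cplx_parallel : forall a k x (l i j : 'I_n), chart_im a x ->
    pd l (fun y => cplx a k y i j) x
    + \sum_h christoffel (metric a) i l h x * cplx a k x h j
    - \sum_h christoffel (metric a) h l j x * cplx a k x i h = 0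
}.

(** * Symplectic bundles with connection *)

(* Both eps_{AB} and eps^{AB} have this matrix, in accordance with the
   conventions xi_B = xi^A eps_{AB} and xi^A = eps^{AB} xi_B. *)
Definition symp (R : realType) (r : nat) : 'M[R[i]]_(r + r) :=
  block_mx 0 1%:M (- 1%:M) 0.

Definition conjmx (R : realType) p q (A : 'M[R[i]]_(p, q)) : 'M[R[i]]_(p, q) :=
  map_mx conjc A.

(* The compact group Sp(r), i.e. Sp(2r, C) intersected with U(2r). *)
Definition in_Sp (R : realType) r (s : 'M[R[i]]_(r + r)) : Prop :=
  s^T *m symp R r *m s = symp R r /\ (conjmx s)^T *m s = 1%:M.

Definition in_sp (R : realType) r (G : 'M[R[i]]_(r + r)) : Prop :=
  G^T *m symp R r + symp R r *m G = 0 /\ (conjmx G)^T + G = 0.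

(* A complex bundle of rank 2r associated to the standard representation of
   Sp(r), with an Sp(r)-connection, given by a local frame over each chart
   domain (charts may be repeated and shrunk at will, so that any such bundle
   is trivial over the domains of some atlas).  With f^a_A the frame over the
   chart a, and all functions read in coordinates,
     f^b_B = sum_A f^a_A (gauge a b)_{AB},
     nabla_k f^a_B = sum_A f^a_A (conn a k)_{AB}. *)
Record sp_bundle (R : realType) n (M : smooth_manifold R n) (r : nat) :=
  SpBundle {
  gauge : chart_index M -> chart_index M -> 'rV[R]_n -> 'M[R[i]]_(r + r);
  conn : chart_index M -> 'I_n -> 'rV[R]_n -> 'M[R[i]]_(r + r);
  gauge_smooth : forall a b i j,
    smoothC (overlap a b) (fun x => gauge a b x i j);
  conn_smooth : forall a k i j, smoothC (chart_im a) (fun x => conn a k x i j);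
  gauge_Sp : forall a b x, overlap a b x -> in_Sp (gauge a b x);
  gauge_id : forall a x, chart_im a x -> gauge a a x = 1%:M;
  gauge_cocycle : forall a b c x, overlap a b x -> overlap a c x ->
    gauge a b x *m gauge b c (transition a b x) = gauge a c x;
  conn_sp : forall a k x, chart_im a x -> in_sp (conn a k x);
  conn_gauge : forall a b k x, overlap a b x ->
    gauge a b x *m
      (\sum_l ('J (transition a b) x k l)%:C *: conn b l (transition a b x))
    = conn a k x *m gauge a b x
      + \matrix_(i, j) pdC k (fun y => gauge a b y i j) x
}.

Definition flat_bundle (R : realType) n (M : smooth_manifold R n) r
    (B : sp_bundle M r) : Prop :=
  forall a k l x, chart_im a x ->
    (\matrix_(i, j) (pdC k (fun y => conn B a l y i j) x
                     - pdC l (fun y => conn B a k y i j) x))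
    + conn B a k x *m conn B a l x - conn B a l x *m conn B a k x = 0.

(** * The splitting of the complexified tangent bundle as E (x) H *)

Notation Eidx m := 'I_(m + m).
Notation Hidx := 'I_(1 + 1).

Definition pauli (R : realType) (k : 'I_3) : 'M[R[i]]_(1 + 1) :=
  match val k with
  | 0%N => \matrix_(i, j) (if i == j then 0 else 1)
  | 1%N => \matrix_(i, j) (if i == j then 0 else if i == 0 then - imagu R else imagu R)
  | _ => \matrix_(i, j) (if i == j then (if i == 0 then 1 else -1) else 0)
  end.

Definition cmx (R : realType) p q (A : 'M[R]_(p, q)) : 'M[R[i]]_(p, q) :=
  map_mx (fun y : R => y%:C) A.

(* [vielbein a A A' x] is the complex tangent vector e_{AA'} at x, corresponding
   to the product of the A-th frame section of E and the A'-th one of H.  It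
   is automatically a basis by [vielbein_metric]. *)
Record spinor_splitting (R : realType) m (M : smooth_manifold R (4 * m))
    (K : hyperkahler M) := SpinorSplitting {
  bundleE : sp_bundle M m;
  bundleH : sp_bundle M 1;
  flatH : flat_bundle bundleH;
  vielbein : chart_index M -> Eidx m -> Hidx -> 'rV[R]_(4 * m) ->
    'cV[R[i]]_(4 * m);
  vielbein_smooth : forall a A A' i,
    smoothC (chart_im a) (fun x => vielbein a A A' x i 0);
  vielbein_gauge : forall a b B B' x, overlap a b x ->
    vielbein b B B' (transition a b x) =
    \sum_A \sum_A' (gauge bundleE a b x A B * gauge bundleH a b x A' B') *:
      (cmx ('J (transition a b) x)^T *m vielbein a A A' x);
  (* compatibility of the quaternionic structures with complex conjugation *)
  vielbein_real : forall a A A' x, chart_im a x ->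
    conjmx (vielbein a A A' x) =
    \sum_B \sum_B' (symp R m A B * symp R 1 A' B') *: vielbein a B B' x;
  vielbein_metric : forall a A A' B B' x, chart_im a x ->
    ((vielbein a A A' x)^T *m cmx (metric K a x) *m vielbein a B B' x) 0 0 =
    symp R m A B * symp R 1 A' B';
  vielbein_cplx : forall a k B B' x, chart_im a x ->
    cmx (cplx K a k x) *m vielbein a B B' x =
    \sum_A' (- imagu R * pauli R k A' B') *: vielbein a B A' x;
  (* the Levi-Civita connection is the tensor product of the connections of
     E and H *)
  vielbein_parallel : forall a k B B' x (i : 'I_(4 * m)), chart_im a x ->
    pdC k (fun y => vielbein a B B' y i 0) x
    + \sum_l (christoffel (metric K a) i k l x)%:C * vielbein a B B' x l 0 =
    \sum_A conn bundleE a k x A B * vielbein a A B' x i 0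
    + \sum_A' conn bundleH a k x A' B' * vielbein a B A' x i 0
}.

(** * Tensor fields *)

(* Components of a tensor field in the local frames.  A tensor of valence
   (p, q), with p upper E-indices and q lower H-indices, only uses index
   sequences of respective sizes p and q; other components are junk. *)
Definition components (R : realType) m (M : smooth_manifold R (4 * m)) :=
  chart_index M -> seq (Eidx m) -> seq Hidx -> 'rV[R]_(4 * m) -> R[i].

Definition is_tensor (R : realType) m (M : smooth_manifold R (4 * m))
    (K : hyperkahler M) (S : spinor_splitting K) (p q : nat)
    (T : components M) : Prop :=
  (forall a (u : p.-tuple (Eidx m)) (v : q.-tuple Hidx),
     smoothC (chart_im a) (T a u v)) /\
  (forall a b (u : p.-tuple (Eidx m)) (v : q.-tuple Hidx) x, overlap a b x ->
     T b u v (transition a b x) =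
     \sum_(u' : p.-tuple (Eidx m)) \sum_(v' : q.-tuple Hidx)
       (\prod_(i < p) invmx (gauge (bundleE S) a b x) (tnth u i) (tnth u' i)) *
       (\prod_(i < q) gauge (bundleH S) a b x (tnth v' i) (tnth v i)) *
       T a u' v' x).

Definition symmetrize (R : realType) (I : Type) (F : seq I -> R[i])
    (s : seq I) : R[i] :=
  ((size s)`!)%:R^-1 *
  \sum_(g : 'S_(size s))
    F [seq tnth (in_tuple s) (g i) | i <- enum 'I_(size s)].

Definition primed_symmetric (R : realType) m (M : smooth_manifold R (4 * m))
    (p q : nat) (T : components M) : Prop :=
  forall a (u : p.-tuple (Eidx m)) (v : q.-tuple Hidx) x, chart_im a x ->
    T a u v x = symmetrize (fun s => T a u s x) v.

Section CovariantDerivative.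
Context (R : realType) (m : nat) (M : smooth_manifold R (4 * m)).
Context (K : hyperkahler M) (S : spinor_splitting K).
Implicit Types (T : components M) (a : chart_index M) (x : 'rV[R]_(4 * m)).
Implicit Types (u : seq (Eidx m)) (v : seq Hidx).

(* nabla_k T^u_v in the coordinate direction k *)
Definition nabla_coord T a (k : 'I_(4 * m)) u v x : R[i] :=
  pdC k (T a u v) x
  + \sum_(i < size u) \sum_B
      conn (bundleE S) a k x (tnth (in_tuple u) i) B *
      T a (set_nth B u i B) v x
  - \sum_(i < size v) \sum_B'
      conn (bundleH S) a k x B' (tnth (in_tuple v) i) *
      T a u (set_nth B' v i B') x.

(* nabla_{AA'}, nabla^A_{A'} and nabla^{AA'} *)
Definition nabla_dd T a (A : Eidx m) (A' : Hidx) u v x : R[i] :=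
  \sum_k vielbein S a A A' x k 0 * nabla_coord T a k u v x.

Definition nabla_ud T a (A : Eidx m) (A' : Hidx) u v x : R[i] :=
  \sum_B symp R m A B * nabla_dd T a B A' u v x.

Definition nabla_uu T a (A : Eidx m) (A' : Hidx) u v x : R[i] :=
  \sum_B' symp R 1 A' B' * nabla_ud T a A B' u v x.

(* (omega_k)_{AA',BB'} = g(e_{AA'}, I_k e_{BB'}) *)
Definition kahler_form a (k : 'I_3) (A : Eidx m) (A' : Hidx)
    (B : Eidx m) (B' : Hidx) x : R[i] :=
  ((vielbein S a A A' x)^T *m cmx (metric K a x) *m
   (cmx (cplx K a k x) *m vielbein S a B B' x)) 0 0.

(* (omega^{C'}_{D'})_{AA',BB'} *)
Definition omega_ud a (C' D' : Hidx) (A : Eidx m) (A' : Hidx)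
    (B : Eidx m) (B' : Hidx) x : R[i] :=
  2^-1 * \sum_k pauli R k C' D' * kahler_form a k A A' B B' x.

(* (omega_{C'D'})_{AA',BB'} *)
Definition omega_dd a (C' D' : Hidx) (A : Eidx m) (A' : Hidx)
    (B : Eidx m) (B' : Hidx) x : R[i] :=
  \sum_F' omega_ud a F' D' A A' B B' x * symp R 1 F' C'.

End CovariantDerivative.

(** * Killing tensors *)

Definition killing0 (R : realType) m (M : smooth_manifold R (4 * m))
    (K : hyperkahler M) (S : spinor_splitting K) (q : nat)
    (mu : components M) : Prop :=
  [/\ is_tensor S 0 q mu, primed_symmetric 0 q mu &
      forall a x (A : Eidx m) (v : q.+1.-tuple Hidx), chart_im a x ->
        symmetrize (fun s =>
          nabla_dd S mu a A (head ord0 s) [::] (behead s) x) v = 0].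

Definition killing1 (R : realType) m (M : smooth_manifold R (4 * m))
    (K : hyperkahler M) (S : spinor_splitting K) (q : nat)
    (X : components M) : Prop :=
  [/\ is_tensor S 1 q X, primed_symmetric 1 q X &
      forall a x (A B : Eidx m) (v : q.+1.-tuple Hidx), chart_im a x ->
        symmetrize (fun t => symmetrize (fun s =>
          nabla_ud S X a (head A t) (head ord0 s) (behead t) (behead s) x) v)
          [:: A; B] = 0].

Definition tri_hamiltonian_killing1 (R : realType) m
    (M : smooth_manifold R (4 * m)) (K : hyperkahler M)
    (S : spinor_splitting K) (q : nat) (X : components M) : Prop :=
  killing1 S q X /\
  forall a x (A' B' : Hidx) (v : q.+1.-tuple Hidx), chart_im a x ->
    symmetrize (fun s =>
      \sum_C \sum_C' \sum_A
        omega_dd S a A' B' C C' A (head ord0 s) x *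
        nabla_uu S X a C C' [:: A] (behead s) x) v = 0.

(* X^A_{A'_2 ... A'_q} = - i q / (q + 1) nabla^{A A'_1} mu_{A'_1 ... A'_q} *)
Definition killing_potential_tensor (R : realType) m
    (M : smooth_manifold R (4 * m)) (K : hyperkahler M)
    (S : spinor_splitting K) (q : nat) (mu : components M) : components M :=
  fun a u v x =>
    if u is A :: u' then
      - imagu R * (q%:R / q.+1%:R) *
      \sum_A' nabla_uu S mu a A A' u' (A' :: v) x
    else 0.

(* Main.v *)
Require Import Defs.
From mathcomp Require Import all_boot all_order all_algebra fingroup perm.
From mathcomp Require Import complex ring.
From mathcomp Require Import boolp classical_sets functions reals.
From mathcomp Require Import topology normedtype derive landau.

Set Implicit Arguments.
Unset Strict Implicit.
Unset Printing Implicit Defensive.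

Import Order.TTheory GRing.Theory Num.Theory.
Import numFieldNormedType.Exports.
Local Open Scope classical_set_scope.
Local Open Scope ring_scope.
Local Open Scope complex_scope.

(** Let q be the valence of mu.  The decomposition of H (x) S^q H into S^(q+1) H
    and S^(q-1) H shows that the Killing equation kills everything in nabla mu
    but its trace, which is X up to a constant ([spinor_reconstruct]).  This is
    the formula for nabla mu ([nabla_ud_mu]).

    As both symplectic forms and the splitting of the tangent bundle are
    parallel, nabla X is the trace of nabla nabla mu ([nabla_potential]), and
    the derivative of the Killing equation gives in the same way ([ddmu_uuE])
      nabla^C_{C'} nabla^A_{A'} mu_{A'_1 ... A'_q}
        = - i eps_{A'(A'_1} nabla^C_{|C'|} X^A_{A'_2 ... A'_q)}.
    The curvature of H is zero and the Levi-Civita connection has no torsion, so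
    that the second derivatives of mu commute: the left-hand side is invariant
    under the exchange of (C, C') with (A, A') ([ddmu_uu_sym]).  This has two
    consequences.

    - Its trace over C' and A' is skew in C and A.  On the right-hand side the
      trace replaces C' by A'_1, and the part symmetric in C and A is the Killing
      equation of X ([nabla_potential_skew]).
    - Its trace over C and A is skew in C' and A'.  Hence
      eps_{A'(A'_1} nabla_{|C C'|} X^C_{A'_2 ... A'_q)} has no part symmetric in
      C' and A'; by the completeness relation of the Pauli matrices
      ([omega_ddE]) this is the tri-Hamiltonian equation ([triham_potential]).

    The same calculus shows that X is a tensor: covariant derivatives commute
    with changes of frame ([cov_gauge_act]), and the contractions that define X
    are invariant under the symplectic groups ([potential_gauge]).

    Throughout, a tensor with lower indices is a function of the sequence of its
    indices; the actions of matrices on it ([lie_act], [gauge_act]) are then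
    open to induction on that sequence, and total symmetrization is an average
    over rearrangements of it. *)

(** * Partial derivatives and smooth functions *)

Section Calculus.
Variables (R : realType) (n : nat).
Implicit Types (D : set 'rV[R]_n) (f g : 'rV[R]_n -> R) (x : 'rV[R]_n).

(** The difference g - f vanishes near x, so its differential at x is zero. *)
Lemma near_eq_differentiable f g x :
  (\near x, f x = g x) -> differentiable f x -> differentiable g x.
Proof.
move=> fg df.
have -> : g = f + (g - f) by apply/funext => y; rewrite !fctE addrC subrK.
apply: differentiableD => //.
have h0 : \forall y \near x, (g - f) y = 0.
  by near=> y; rewrite !fctE; apply/eqP; rewrite subr_eq0 eq_sym; apply/eqP; near: y.
apply/diff_locallyP.
have hx0 : (g - f) x = 0 by exact: nbhs_singleton h0.
have E : (g - f) \o shift x = cst ((g - f) x) + 0 +o_ (0:'rV[R]_n) id.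
  apply/eqaddoP => e e0.
  have h1 : \forall h \near (0:'rV[R]_n), (g - f) (h + x) = 0.
    by move: h0; rewrite (near_shift 0 x) subr0.
  near=> h.
  rewrite hx0 !fctE /= addr0 subr0.
  have -> : g (h + x) - f (h + x) = 0 by near: h; apply: h1.
  by rewrite normr0 mulr_ge0 // ltW.
have dl : 'd (g - f) x = (\0 : {linear 'rV[R]_n -> R}) :> ('rV[R]_n -> R).
  by apply: diff_unique => //; exact: cst_continuous.
by rewrite dl; split; [exact: cst_continuous | exact: E].
Unshelve. all: by end_near. Qed.

Lemma near_eq_pd f g x k : (\near x, f x = g x) -> pd k f x = pd k g x.
Proof. exact: near_eq_derive. Qed.

Lemma open_near_eq D f g x : open D -> (forall y, D y -> f y = g y) -> D x ->
  \forall y \near x, f y = g y.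
Proof.
move=> oD fg Dx; have := open_nbhs_nbhs (conj oD Dx).
by apply: filterS.
Qed.

(** The rules for the derivatives of sums and products only hold on D, so that
    the closure properties of [Ck] below rest on its insensitivity to the values
    of a function off D. *)
Lemma eq_Ck D r f g : open D -> (forall y, D y -> f y = g y) ->
  Ck r D f -> Ck r D g.
Proof.
move=> oD; elim: r f g => [|r IH] f g fg /=.
  move=> cf x Dx.
  have := cf x Dx; rewrite /prop_for /continuous_at -fg // => h.
  by apply: (cvg_trans _ h); have /near_eq_cvg := open_near_eq oD fg Dx.
move=> [df cf]; split => [x Dx|k].
  exact: near_eq_differentiable (open_near_eq oD fg Dx) (df x Dx).
apply: (IH (pd k f)) (cf k) => y Dy.
exact/near_eq_pd/(open_near_eq oD fg).
Unshelve. all: by end_near. Qed.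

Lemma CkS D r f : Ck r.+1 D f -> Ck r D f.
Proof.
elim: r f => [|r IH] f [df cf].
  by move=> x Dx; apply: differentiable_continuous; exact: df.
by split => // k; exact/IH/cf.
Qed.

Lemma pdD f g x k : differentiable f x -> differentiable g x ->
  pd k (fun y => f y + g y) x = pd k f x + pd k g x.
Proof. by move=> df dg; apply: deriveD; exact: diff_derivable. Qed.

Lemma pdN f x k : differentiable f x -> pd k (fun y => - f y) x = - pd k f x.
Proof. by move=> df; apply: deriveN; exact: diff_derivable. Qed.

Lemma pdM f g x k : differentiable f x -> differentiable g x ->
  pd k (fun y => f y * g y) x = f x * pd k g x + pd k f x * g x.
Proof.
move=> df dg; rewrite [pd k f x * _]mulrC.
by apply: deriveM; exact: diff_derivable.
Qed.

Lemma pd_cst (c : R) x k : pd k (fun=> c) x = 0.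
Proof. exact: derive_cst. Qed.

Lemma Ck_cst D r (c : R) : Ck r D (fun=> c).
Proof.
elim: r c => [|r IH] c /=; first by move=> x _; exact: cst_continuous.
split=> [x _|k]; first exact: differentiable_cst.
by rewrite (_ : pd k _ = fun=> 0) //; apply/funext => x; rewrite pd_cst.
Qed.

Lemma CkD D r f g : open D -> Ck r D f -> Ck r D g ->
  Ck r D (fun y => f y + g y).
Proof.
move=> oD; elim: r f g => [|r IH] f g /=.
  by move=> cf cg x Dx; apply: continuousD; [exact: cf|exact: cg].
move=> [df cf] [dg cg]; split=> [x Dx|k].
  by apply: differentiableD; [exact: df|exact: dg].
apply: eq_Ck (IH _ _ (cf k) (cg k)) => // y Dy.
by rewrite pdD //; [exact: df|exact: dg].
Qed.

Lemma CkN D r f : open D -> Ck r D f -> Ck r D (fun y => - f y).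
Proof.
move=> oD; elim: r f => [|r IH] f /=.
  by move=> cf x Dx; apply: continuousN; exact: cf.
move=> [df cf]; split=> [x Dx|k].
  by apply: differentiableN; exact: df.
apply: eq_Ck (IH _ (cf k)) => // y Dy.
by rewrite pdN //; exact: df.
Qed.

Lemma CkM D r f g : open D -> Ck r D f -> Ck r D g ->
  Ck r D (fun y => f y * g y).
Proof.
move=> oD; elim: r f g => [|r IH] f g.
  by move=> cf cg x Dx; apply: continuousM; [exact: cf|exact: cg].
move=> cf cg; have [[df cdf] [dg cdg]] := (cf, cg); split=> [x Dx|k].
  by apply: differentiableM; [exact: df|exact: dg].
apply: (@eq_Ck _ _ (fun y => f y * pd k g y + pd k f y * g y)) => //.
  by move=> y Dy; rewrite pdM //; [exact: df|exact: dg].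
apply: CkD => //; apply: IH; [exact: CkS cf|exact: cdg|exact: cdf|exact: CkS cg].
Qed.

End Calculus.

Section Schwarz.
Variables (R : realType) (n : nat).
Implicit Types (D : set 'rV[R]_n) (f g : 'rV[R]_n -> R) (x v : 'rV[R]_n).

Lemma is_derive_line f x v (s : R) : differentiable f (x + s *: v) ->
  is_derive s 1 (fun t : R => f (x + t *: v)) ('D_v f (x + s *: v)).
Proof.
move=> df; have [ex lim] := derivableP (@diff_derivable _ _ _ _ _ v df).
have E : (fun h : R => h^-1 *: (((fun t : R => f (x + t *: v)) \o shift s) (h *: (1 : R))
            - f (x + s *: v)))
       = (fun h => h^-1 *: ((f \o shift (x + s *: v)) (h *: v) - f (x + s *: v))).
  apply/funext => h /=; congr (_ *: (f _ - _)).
  by rewrite [h *: 1]mulr1 scalerDl addrCA.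
by apply: DeriveDef; rewrite /derivable /derive E.
Qed.

Lemma derive_shiftr f x a v : 'D_v (fun z => f (z + a)) x = 'D_v f (x + a).
Proof.
rewrite /derive.
have -> // : (fun h : R => h^-1 *: (((fun z => f (z + a)) \o shift x) (h *: v) - f (x + a)))
       = (fun h => h^-1 *: ((f \o shift (x + a)) (h *: v) - f (x + a))).
by apply/funext => h /=; rewrite addrA.
Qed.

Lemma mvt_line f x v (h : R) : 0 < h ->
  (forall s, 0 <= s <= h -> differentiable f (x + s *: v)) ->
  exists2 c, 0 <= c <= h & f (x + h *: v) - f x = 'D_v f (x + c *: v) * h.
Proof.
move=> h0 df.
have [||c] := @MVT R (fun t => f (x + t *: v)) (fun s => 'D_v f (x + s *: v)) 0 h h0.
- move=> s; rewrite in_itv /= => /andP[s0 sh]; apply: is_derive_line.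
  by apply: df; rewrite !ltW.
- apply: derivable_within_continuous => s; rewrite in_itv /= => sh.
  by have [] := is_derive_line (df s sh).
rewrite in_itv /= => /andP[c0 ch]; rewrite subr0 scale0r addr0 => ->.
by exists c => //; rewrite !ltW.
Qed.

(** The mean value theorem, applied along e_k to f (z + h e_l) - f z and
    then along e_l to the k-th partial derivative of f, turns the second
    difference of f into a mixed second derivative at a nearby point. *)
Lemma second_difference f x (k l : 'I_n) (r h : R) :
  let K := `|delta_mx 0 k : 'rV[R]_n| + `|delta_mx 0 l : 'rV[R]_n| in
  Ck 2 [set y | `|x - y| < r] f -> 0 < h -> h * K < r ->
  exists2 y, `|x - y| <= h * K &
    f (x + h *: delta_mx 0 k + h *: delta_mx 0 l) - f (x + h *: delta_mx 0 k)
      - (f (x + h *: delta_mx 0 l) - f x)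
    = pd l (pd k f) y * h * h.
Proof.
move=> K [df cf] h0 hK.
have near_x s t : 0 <= s <= h -> 0 <= t <= h ->
    `|x - (x + s *: delta_mx 0 k + t *: delta_mx 0 l)| <= h * K.
  move=> /andP[s0 sh] /andP[t0 th].
  rewrite -addrA opprD addrA subrr add0r normrN.
  apply: le_trans (ler_normD _ _) _; rewrite !normrZ !ger0_norm // mulrDr.
  by apply: lerD; apply: ler_wpM2r.
have lt_x s t : 0 <= s <= h -> 0 <= t <= h ->
    `|x - (x + s *: delta_mx 0 k + t *: delta_mx 0 l)| < r.
  by move=> ? ?; apply: le_lt_trans hK; exact: near_x.
have h00 : 0 <= (0:R) <= h by rewrite lexx ltW.
have hhh : 0 <= h <= h by rewrite lexx ltW.
have shift0 s : x + s *: delta_mx 0 k = x + s *: delta_mx 0 k + 0 *: delta_mx 0 l.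
  by rewrite scale0r addr0.
pose G z := f (z + h *: delta_mx 0 l) - f z.
have dfl s : 0 <= s <= h ->
    differentiable (fun z => f (z + h *: delta_mx 0 l)) (x + s *: delta_mx 0 k).
  move=> sh; apply: (@differentiable_comp _ _ _ _ (fun z => z + h *: delta_mx 0 l) f).
    by apply: (differentiableD (f := id) (g := cst _)); [|exact: differentiable_cst].
  by apply: df; exact: lt_x.
have dfs s : 0 <= s <= h -> differentiable f (x + s *: delta_mx 0 k).
  by move=> sh; rewrite shift0; apply: df; exact: lt_x.
have [|c ch] := @mvt_line G x (delta_mx 0 k) h h0.
  by move=> s sh; apply: differentiableB; [exact: dfl|exact: dfs].
rewrite /G => ->.
rewrite [X in X * h](_ : _ = pd k f (x + c *: delta_mx 0 k + h *: delta_mx 0 l)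
   - pd k f (x + c *: delta_mx 0 k)); last first.
  rewrite deriveB; [|exact/diff_derivable/dfl|exact/diff_derivable/dfs].
  by rewrite derive_shiftr.
have [|d dh] := @mvt_line (pd k f) (x + c *: delta_mx 0 k) (delta_mx 0 l) h h0.
  by move=> s sh; have [+ _] := cf k; apply; exact: lt_x.
move=> ->; exists (x + c *: delta_mx 0 k + d *: delta_mx 0 l) => //.
exact: near_x.
Qed.

Lemma continuous_pair_ball D f g x (d : R) : open D -> D x ->
  {for x, continuous f} -> {for x, continuous g} -> 0 < d ->
  exists2 r : R, 0 < r & forall y, `|x - y| < r ->
    [/\ D y, `|f x - f y| < d & `|g x - g y| < d].
Proof.
move=> oD Dx /cvgrPdist_lt cf /cvgrPdist_lt cg d0.
have c0 := open_nbhs_nbhs (conj oD Dx).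
have : \forall y \near x, [/\ D y, `|f x - f y| < d & `|g x - g y| < d].
  by near=> y; split; near: y; [exact: c0|exact: cf|exact: cg].
by move=> /nbhs_normP[r /= r0 H]; exists r.
Unshelve. all: by end_near. Qed.

(** Schwarz's theorem.  The second difference of f does not depend on the
    order of the two directions, and [second_difference] makes it a value of
    either mixed derivative close to x; both are continuous at x. *)
Lemma pd_pd_comm D f x (k l : 'I_n) : open D -> D x -> Ck 2 D f ->
  pd k (pd l f) x = pd l (pd k f) x.
Proof.
move=> oD Dx cf.
pose K := `|delta_mx 0 k : 'rV[R]_n| + `|delta_mx 0 l : 'rV[R]_n|.
have K0 : 0 <= K by rewrite addr_ge0.
apply/eqP; rewrite -subr_eq0 -normr_le0; apply/ler_addgt0Pl => /= e e0; rewrite addr0.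
have e20 : 0 < e / 2 by rewrite divr_gt0.
have [_ cf1] := cf.
have ckl : {for x, continuous (pd k (pd l f))} by have [_ /(_ k)] := cf1 l; apply.
have clk : {for x, continuous (pd l (pd k f))} by have [_ /(_ l)] := cf1 k; apply.
have [r r0 H] := continuous_pair_ball oD Dx ckl clk e20.
have cfr : Ck 2 [set y | `|x - y| < r] f.
  have sub y : `|x - y| < r -> D y by move=> /H[].
  have [df cdf] := cf; split => [y /sub|i]; first exact: df.
  have [ddf cddf] := cdf i; split => [y /sub|i']; first exact: ddf.
  by move=> y /sub; exact: cddf.
(* K may be zero, so K + 1 stands for the bound on the length of e_k + e_l. *)
pose h := r / (K + 1).
have h0 : 0 < h by rewrite divr_gt0 // ltr_wpDl.
have hK : h * K < r.
  by rewrite /h mulrAC ltr_pdivrMr ?ltr_wpDl // ltr_pM2l // ltrDl.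
have [y xy E1] := second_difference cfr h0 hK.
have hK' : h * (`|delta_mx 0 l : 'rV[R]_n| + `|delta_mx 0 k : 'rV[R]_n|) < r.
  by rewrite [_ + `|delta_mx 0 k|]addrC.
have [z xz E2] := second_difference cfr h0 hK'.
have Eyz : pd l (pd k f) y = pd k (pd l f) z.
  apply: (mulIf (lt0r_neq0 h0)); apply: (mulIf (lt0r_neq0 h0)).
  apply: (etrans (esym E1)); apply: (etrans _ E2).
  rewrite [x + h *: delta_mx 0 l + _]addrAC.
  by move: (f _) (f _) (f _) (f x) => a1 a2 a3 a4; ring.
have [_ _ H1] := H y (le_lt_trans xy hK).
have [_ H2 _] := H z (le_lt_trans xz hK').
move: H1 H2; rewrite Eyz.
move: (pd k (pd l f) z) (pd k (pd l f) x) (pd l (pd k f) x) => c a b bc ac.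
rewrite [e]splitr; apply: le_trans (ler_distD c _ _) _.
by rewrite [`|c - b|]distrC; apply: lerD; exact: ltW.
Qed.

End Schwarz.

Section ComplexCalculus.
Variables (R : realType) (n : nat).
Implicit Types (D : set 'rV[R]_n) (f g : 'rV[R]_n -> R[i]) (x : 'rV[R]_n).

Definition differentiableC f x :=
  differentiable (fun y => complex.Re (f y)) x /\
  differentiable (fun y => complex.Im (f y)) x.

Lemma ReD (z w : R[i]) : complex.Re (z + w) = complex.Re z + complex.Re w.
Proof. by case: z; case: w. Qed.
Lemma ImD (z w : R[i]) : complex.Im (z + w) = complex.Im z + complex.Im w.
Proof. by case: z; case: w. Qed.
Lemma ReM (z w : R[i]) : complex.Re (z * w) =
  complex.Re z * complex.Re w + - (complex.Im z * complex.Im w).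
Proof. by case: z; case: w. Qed.
Lemma ImM (z w : R[i]) : complex.Im (z * w) =
  complex.Re z * complex.Im w + complex.Im z * complex.Re w.
Proof. by case: z; case: w. Qed.

Lemma addcE (a b c d : R) : (a +i* b) + (c +i* d) = (a + c) +i* (b + d).
Proof. by []. Qed.
Lemma mulcE (a b c d : R) :
  (a +i* b) * (c +i* d) = (a * c - b * d) +i* (a * d + b * c).
Proof. by []. Qed.

Lemma differentiableC_cst (c : R[i]) x : differentiableC (fun=> c) x.
Proof. by split; exact: differentiable_cst. Qed.

Lemma differentiableCD f g x : differentiableC f x -> differentiableC g x ->
  differentiableC (fun y => f y + g y) x.
Proof.
move=> [f1 f2] [g1 g2]; split.
  by under eq_fun do rewrite ReD; exact: differentiableD.
by under eq_fun do rewrite ImD; exact: differentiableD.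
Qed.

Lemma differentiableCM f g x : differentiableC f x -> differentiableC g x ->
  differentiableC (fun y => f y * g y) x.
Proof.
move=> [f1 f2] [g1 g2]; split.
  under eq_fun do rewrite ReM.
  apply: differentiableD; first exact: differentiableM.
  by apply: differentiableN; exact: differentiableM.
by under eq_fun do rewrite ImM; apply: differentiableD; exact: differentiableM.
Qed.

Lemma differentiableC_sum (I : Type) (r : seq I) (F : I -> 'rV[R]_n -> R[i]) x :
  (forall i, differentiableC (F i) x) ->
  differentiableC (fun y => \sum_(i <- r) F i y) x.
Proof.
move=> dF; elim: r => [|i r IH].
  by under eq_fun do rewrite big_nil; exact: differentiableC_cst.
by under eq_fun do rewrite big_cons; exact: differentiableCD.
Qed.

Lemma pdC_cst (c : R[i]) x k : pdC k (fun=> c) x = 0.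
Proof. by rewrite /pdC !pd_cst. Qed.

Lemma pdCD f g x k : differentiableC f x -> differentiableC g x ->
  pdC k (fun y => f y + g y) x = pdC k f x + pdC k g x.
Proof.
move=> [f1 f2] [g1 g2]; rewrite /pdC addcE.
under eq_fun do rewrite ReD.
under [X in _ +i* pd _ X _]eq_fun do rewrite ImD.
by rewrite !pdD.
Qed.

Lemma pdCM f g x k : differentiableC f x -> differentiableC g x ->
  pdC k (fun y => f y * g y) x = pdC k f x * g x + f x * pdC k g x.
Proof.
move=> [f1 f2] [g1 g2]; rewrite /pdC.
under eq_fun do rewrite ReM.
under [X in _ +i* pd _ X _]eq_fun do rewrite ImM.
have d1 := differentiableM f1 g1; have d2 := differentiableM f2 g2.
have d3 := differentiableM f1 g2; have d4 := differentiableM f2 g1.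
rewrite !pdD ?pdN ?pdM //; last exact: differentiableN.
case: (f x) (g x) => a b [c d] /=; rewrite !mulcE addcE.
by congr (_ +i* _); ring.
Qed.

Lemma pdC_sum (I : Type) (r : seq I) (F : I -> 'rV[R]_n -> R[i]) x k :
  (forall i, differentiableC (F i) x) ->
  pdC k (fun y => \sum_(i <- r) F i y) x = \sum_(i <- r) pdC k (F i) x.
Proof.
move=> dF; elim: r => [|i r IH].
  by under eq_fun do rewrite big_nil; rewrite pdC_cst big_nil.
under eq_fun do rewrite big_cons; rewrite pdCD //; last exact: differentiableC_sum.
by rewrite IH big_cons.
Qed.

Lemma pdCZ (c : R[i]) f x k : differentiableC f x ->
  pdC k (fun y => c * f y) x = c * pdC k f x.
Proof.
move=> df; rewrite (pdCM k (differentiableC_cst c x) df).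
by rewrite pdC_cst mul0r add0r.
Qed.

Lemma near_eq_pdC D f g x k : open D -> (forall y, D y -> f y = g y) -> D x ->
  pdC k f x = pdC k g x.
Proof.
move=> oD fg Dx.
by congr (_ +i* _); apply/near_eq_pd/(open_near_eq oD _ Dx) => y /fg ->.
Qed.

Lemma smoothC_differentiable D f x : smoothC D f -> D x -> differentiableC f x.
Proof. by move=> [/(_ 1%N)[f1 _] /(_ 1%N)[f2 _]] Dx; split; [exact: f1|exact: f2]. Qed.

Lemma smoothC_cst D (c : R[i]) : smoothC D (fun=> c).
Proof. by split=> r; exact: Ck_cst. Qed.

Lemma smoothCD D f g : open D -> smoothC D f -> smoothC D g ->
  smoothC D (fun y => f y + g y).
Proof.
move=> oD [f1 f2] [g1 g2]; split=> r.
  by under eq_fun do rewrite ReD; exact: CkD.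
by under eq_fun do rewrite ImD; exact: CkD.
Qed.

Lemma smoothCM D f g : open D -> smoothC D f -> smoothC D g ->
  smoothC D (fun y => f y * g y).
Proof.
move=> oD [f1 f2] [g1 g2]; split=> r.
  under eq_fun do rewrite ReM.
  by apply: CkD => //; [exact: CkM|apply: CkN => //; exact: CkM].
by under eq_fun do rewrite ImM; apply: CkD => //; exact: CkM.
Qed.

Lemma smoothC_sum D (I : Type) (r : seq I) (F : I -> 'rV[R]_n -> R[i]) :
  open D -> (forall i, smoothC D (F i)) ->
  smoothC D (fun y => \sum_(i <- r) F i y).
Proof.
move=> oD sF; elim: r => [|i r IH].
  by under eq_fun do rewrite big_nil; exact: smoothC_cst.
by under eq_fun do rewrite big_cons; exact: smoothCD.
Qed.

Lemma smoothC_pdC D f k : smoothC D f -> smoothC D (pdC k f).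
Proof. by move=> [f1 f2]; split=> r; [exact: (f1 r.+1).2 k|exact: (f2 r.+1).2 k]. Qed.

Lemma pdC_pdC_comm D f x k l : open D -> D x -> smoothC D f ->
  pdC k (pdC l f) x = pdC l (pdC k f) x.
Proof.
move=> oD Dx [f1 f2].
exact: (congr2 (@Complex R) (pd_pd_comm k l oD Dx (f1 2%N))
                            (pd_pd_comm k l oD Dx (f2 2%N))).
Qed.

(** A map is the sum of its coordinates times the vectors of the standard basis. *)
Lemma differentiable_rV (t : 'rV[R]_n -> 'rV[R]_n) x :
  (forall i, differentiable (fun y => t y 0 i) x) -> differentiable t x.
Proof.
move=> dt; have -> : t = \sum_i (fun y => t y 0 i *: delta_mx 0 i).
  by apply/funext => y; rewrite fct_sumE [LHS]row_sum_delta.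
by apply: differentiable_sum => i; exact: differentiableZl.
Qed.

Lemma pd_comp (t : 'rV[R]_n -> 'rV[R]_n) (f : 'rV[R]_n -> R) x k :
  differentiable t x -> differentiable f (t x) ->
  pd k (fun y => f (t y)) x = \sum_l 'J t x k l * pd l f (t x).
Proof.
move=> dt df; rewrite /pd deriveE; last exact: differentiable_comp.
rewrite (diff_comp dt df) /=.
have -> : 'd t x (delta_mx 0 k) = row k ('J t x).
  by rewrite -deriveE // deriveEjacobian // -rowE.
rewrite [row k _]row_sum_delta linear_sum /=; apply: eq_bigr => l _.
by rewrite linearZ /= mxE deriveE.
Qed.

Lemma pdC_comp (t : 'rV[R]_n -> 'rV[R]_n) f x k :
  differentiable t x -> differentiableC f (t x) ->
  pdC k (fun y => f (t y)) x = \sum_l ('J t x k l)%:C * pdC l f (t x).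
Proof.
move=> dt [f1 f2]; rewrite /pdC (pd_comp k dt f1) (pd_comp k dt f2).
apply: (big_rec3 (fun a b (c : R[i]) => a +i* b = c)) => // l a b c _ <-.
rewrite -complexr0 mulcE addcE.
by congr (_ +i* _); rewrite mul0r ?subr0 ?addr0.
Qed.

End ComplexCalculus.

(** * The action of matrices on the indices of a tensor *)

Section IndexAction.
Variables (F : comNzRingType) (r : nat).
Implicit Types (W g : 'M[F]_r) (t : seq 'I_r -> F) (v s : seq 'I_r).

(** The action of a matrix of a Lie algebra on a tensor with lower indices,
    as a derivation over the indices: the zeroth order term of a covariant
    derivative. *)
Definition lie_act W t v : F :=
  \sum_(i < size v) \sum_b W b (tnth (in_tuple v) i) * t (set_nth b v i b).

(** The corresponding group action, by a change of frame.  It is the sum over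
    tuples of [gauge_act_tuple], in a form suited to induction on the sequence
    of indices. *)
Fixpoint gauge_act g t v : F :=
  if v is c :: v' then \sum_b g b c * gauge_act g (fun s => t (b :: s)) v'
  else t [::].

Lemma lie_act_nil W t : lie_act W t [::] = 0.
Proof. by rewrite /lie_act big_ord0. Qed.

Lemma lie_act_cons W t c v : lie_act W t (c :: v) =
  \sum_b W b c * t (b :: v) + lie_act W (fun s => t (c :: s)) v.
Proof.
rewrite /lie_act big_ord_recl; congr (_ + _); apply: eq_bigr => i _.
apply: eq_bigr => b _; rewrite lift0 /=; congr (W _ _ * _).
by rewrite !(tnth_nth c).
Qed.

Lemma eq_lie_act W t t' v : (forall s, size s = size v -> t s = t' s) ->
  lie_act W t v = lie_act W t' v.
Proof.
move=> tt'; apply: eq_bigr => i _; apply: eq_bigr => b _; rewrite tt' //.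
by rewrite size_set_nth; apply/maxn_idPr.
Qed.

Lemma lie_act_sum W (I : Type) (z : seq I) (f : I -> F) (T : I -> seq 'I_r -> F) v :
  lie_act W (fun s => \sum_(k <- z) f k * T k s) v = \sum_(k <- z) f k * lie_act W (T k) v.
Proof.
rewrite /lie_act; under [RHS]eq_bigr do rewrite mulr_sumr.
rewrite [RHS]exchange_big; apply: eq_bigr => i _.
under [RHS]eq_bigr do rewrite mulr_sumr.
rewrite [RHS]exchange_big; apply: eq_bigr => b _.
by rewrite mulr_sumr; apply: eq_bigr => k _; rewrite mulrCA.
Qed.

Lemma lie_actD W t t' v : lie_act W (fun s => t s + t' s) v = lie_act W t v + lie_act W t' v.
Proof.
rewrite -big_split; apply: eq_bigr => i _; rewrite -big_split.
by apply: eq_bigr => b _; rewrite mulrDr.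
Qed.

Lemma lie_actZ W (c : F) t v : lie_act W (fun s => c * t s) v = c * lie_act W t v.
Proof.
rewrite mulr_sumr; apply: eq_bigr => i _; rewrite mulr_sumr.
by apply: eq_bigr => b _; rewrite mulrCA.
Qed.

Lemma lie_actB W t t' v : lie_act W (fun s => t s - t' s) v = lie_act W t v - lie_act W t' v.
Proof.
rewrite (eq_lie_act W (t' := fun s => t s + -1 * t' s)); last by move=> s _; rewrite mulN1r.
by rewrite lie_actD lie_actZ mulN1r.
Qed.

Lemma lie_actBm W W' t v : lie_act (W - W') t v = lie_act W t v - lie_act W' t v.
Proof.
rewrite -sumrB; apply: eq_bigr => i _; rewrite -sumrB.
by apply: eq_bigr => b _; rewrite !mxE mulrBl.
Qed.

Lemma lie_act0m t v : lie_act 0 t v = 0.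
Proof. by apply: big1 => i _; apply: big1 => b _; rewrite mxE mul0r. Qed.

(** Terms that involve two different indices cancel; on a single index the
    commutator remains, in reverse order because lower indices carry the
    transposed action. *)
Lemma lie_act_comm W W' t v : lie_act W (lie_act W' t) v - lie_act W' (lie_act W t) v =
  lie_act (W' *m W - W *m W') t v.
Proof.
elim: v t => [|c v IH] t; first by rewrite !lie_act_nil subrr.
have expand V V' : lie_act V (lie_act V' t) (c :: v) =
    \sum_d (V' *m V) d c * t (d :: v)
    + \sum_b V b c * lie_act V' (fun s => t (b :: s)) v
    + \sum_b V' b c * lie_act V (fun s => t (b :: s)) v
    + lie_act V (lie_act V' (fun s => t (c :: s))) v.
  rewrite lie_act_cons.
  rewrite (eq_lie_act V (t' := fun s => \sum_b V' b c * t (b :: s)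
     + lie_act V' (fun s => t (c :: s)) s)); last by move=> s _; rewrite lie_act_cons.
  rewrite lie_actD lie_act_sum addrA; congr (_ + _ + _).
  rewrite [in RHS](eq_bigr (fun d => \sum_b V b c * (V' d b * t (d :: v)))); last first.
    move=> d _; rewrite mxE mulr_suml; apply: eq_bigr => b _.
    by rewrite mulrA [V b c * _]mulrC.
  rewrite [in RHS]exchange_big -big_split; apply: eq_bigr => b _.
  by rewrite lie_act_cons mulrDr mulr_sumr.
rewrite !expand lie_act_cons -IH.
under [in RHS]eq_bigr do rewrite [fun_of_matrix (_ - _) _ _]mxE [fun_of_matrix (- _) _ _]mxE mulrBl.
rewrite sumrB; set a1 := \sum_d _; set a2 := \sum_b _; set a3 := \sum_b _.
set b1 := \sum_d _; move: (lie_act _ _ v) (lie_act _ _ v) => e1 e2; ring.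
Qed.

Lemma eq_gauge_act g t t' v : (forall s, size s = size v -> t s = t' s) ->
  gauge_act g t v = gauge_act g t' v.
Proof.
elim: v t t' => [|c v IH] t t' tt' /=; first exact: tt'.
apply: eq_bigr => b _; congr (_ * _); apply: IH => s sv.
by apply: tt'; rewrite /= sv.
Qed.

Lemma gauge_actB g t t' v : gauge_act g (fun s => t s - t' s) v = gauge_act g t v - gauge_act g t' v.
Proof.
elim: v t t' => [//|c v IH] t t' /=; rewrite -sumrB.
by apply: eq_bigr => b _; rewrite IH mulrBr.
Qed.

Lemma gauge_actZ g (a : F) t v : gauge_act g (fun s => a * t s) v = a * gauge_act g t v.
Proof.
elim: v t => [//|c v IH] t /=; rewrite mulr_sumr.
by apply: eq_bigr => b _; rewrite IH mulrCA.
Qed.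

Lemma gauge_act_sum g (I : Type) (z : seq I) (f : I -> F) (T : I -> seq 'I_r -> F) v :
  gauge_act g (fun s => \sum_(k <- z) f k * T k s) v = \sum_(k <- z) f k * gauge_act g (T k) v.
Proof.
elim: v T => [//|c v IH] T /=.
under eq_bigr do rewrite IH mulr_sumr.
rewrite exchange_big; apply: eq_bigr => k _; rewrite mulr_sumr.
by apply: eq_bigr => b _; rewrite mulrCA.
Qed.

Lemma big_tuple_cons q (G : q.+1.-tuple 'I_r -> F) :
  \sum_t G t = \sum_b \sum_(t : q.-tuple 'I_r) G [tuple of b :: t].
Proof.
rewrite pair_big /= (reindex (fun p : 'I_r * q.-tuple 'I_r => [tuple of p.1 :: p.2])) //=.
exists (fun t : q.+1.-tuple 'I_r => (thead t, [tuple of behead t])) => [[b t] _|t _] /=.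
  by congr (_, _); apply: val_inj.
by rewrite [RHS]tuple_eta.
Qed.

Lemma gauge_act_tuple g t q (v : q.-tuple 'I_r) :
  \sum_(w : q.-tuple 'I_r) (\prod_(i < q) g (tnth w i) (tnth v i)) * t w
  = gauge_act g t v.
Proof.
elim: q v t => [|q IH] v t.
  rewrite (tuple0 v) /= (big_pred1 [tuple]) => [|w]; last by rewrite [w]tuple0 /= eqxx.
  by rewrite big_ord0 mul1r.
rewrite big_tuple_cons; case/tupleP: v => c v /=.
apply: eq_bigr => b _; rewrite -IH mulr_sumr; apply: eq_bigr => w _.
rewrite big_ord_recl !tnth0 -mulrA; congr (_ * (_ * _)).
by apply: eq_bigr => i _; rewrite !tnthS.
Qed.

End IndexAction.

(** * Symmetrization *)

Section Symmetrize.
Variables (R : realType).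

Definition permute (I : Type) n (t : n.-tuple I) (g : 'S_n) : n.-tuple I :=
  [tuple tnth t (g i) | i < n].

Lemma permute_perm_eq (I : eqType) n (t : n.-tuple I) g : perm_eq (permute t g) t.
Proof. by apply/tuple_permP; exists g. Qed.

Lemma permuteM (I : Type) n (t : n.-tuple I) (g h : 'S_n) :
  permute (permute t g) h = permute t (h * g)%g.
Proof. by apply: eq_from_tnth => i; rewrite !tnth_mktuple permM. Qed.

Lemma symmetrizeE (I : Type) (F : seq I -> R[i]) n (t : n.-tuple I) :
  symmetrize F t = (n`!)%:R^-1 * \sum_(g : 'S_n) F (permute t g).
Proof.
case: t => s sz; have E := eqP sz; subst n; rewrite /symmetrize /=.
congr (_ * _); apply: eq_bigr => g _; congr F; rewrite /permute /=.
apply: eq_map => i; case: s sz g i => [|c s] sz g i; first by case: i.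
by rewrite !(tnth_nth c).
Qed.

Lemma fact_neq0 n : (n`!)%:R != 0 :> R[i].
Proof. by rewrite pnatr_eq0 -lt0n fact_gt0. Qed.

Lemma eq_symmetrize (I : eqType) (F F' : seq I -> R[i]) v :
  (forall s, perm_eq s v -> F s = F' s) -> symmetrize F v = symmetrize F' v.
Proof.
move=> FF'; rewrite -[v]/(tval (in_tuple v)) !symmetrizeE.
by congr (_ * _); apply: eq_bigr => g _; apply: FF'; exact: permute_perm_eq.
Qed.

Lemma symmetrize_id (I : eqType) (F : seq I -> R[i]) v :
  (forall s, perm_eq s v -> F s = F v) -> symmetrize F v = F v.
Proof.
move=> FF'; rewrite (eq_symmetrize FF') -[v]/(tval (in_tuple v)) symmetrizeE.
by rewrite sumr_const card_Sn -[X in _ * X]mulr_natl mulKf // fact_neq0.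
Qed.

Lemma symmetrize_perm (I : eqType) (F : seq I -> R[i]) s v :
  perm_eq s v -> symmetrize F s = symmetrize F v.
Proof.
rewrite -[v]/(tval (in_tuple v)) => /tuple_permP[g ->].
rewrite !symmetrizeE; congr (_ * _).
rewrite [RHS](reindex (fun h : 'S_(size v) => (h * g)%g)); last first.
  by exists (fun h : 'S_(size v) => (h * g^-1)%g) => h _; rewrite ?mulgK ?mulgKV.
by apply: eq_bigr => h _; rewrite -permuteM.
Qed.

Lemma symmetrize_sum (I J : Type) (z : seq J) (f : J -> R[i])
    (F : J -> seq I -> R[i]) v :
  symmetrize (fun s => \sum_(k <- z) f k * F k s) v
  = \sum_(k <- z) f k * symmetrize (F k) v.
Proof.
rewrite /symmetrize exchange_big /= mulr_sumr; apply: eq_bigr => k _.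
by rewrite -mulr_sumr mulrCA.
Qed.

Lemma symmetrizeD (I : Type) (F G : seq I -> R[i]) v :
  symmetrize (fun s => F s + G s) v = symmetrize F v + symmetrize G v.
Proof. by rewrite /symmetrize big_split mulrDr. Qed.

Lemma symmetrizeZ (I : Type) (c : R[i]) (F : seq I -> R[i]) v :
  symmetrize (fun s => c * F s) v = c * symmetrize F v.
Proof. by rewrite /symmetrize -mulr_sumr mulrCA. Qed.

Lemma symmetrizeB (I : Type) (F G : seq I -> R[i]) v :
  symmetrize (fun s => F s - G s) v = symmetrize F v - symmetrize G v.
Proof. by rewrite /symmetrize sumrB mulrBr. Qed.

Lemma ord2P (i : 'I_2) : i = 0 \/ i = 1.
Proof. by case: i => [[|[|//]] ?]; [left|right]; exact: val_inj. Qed.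

Lemma symmetrize_pair (I : Type) (F : seq I -> R[i]) a b :
  symmetrize F [:: a; b] = 2^-1 * (F [:: a; b] + F [:: b; a]).
Proof.
rewrite -[[:: a; b]]/(tval [tuple a; b]) symmetrizeE; congr (_ * _).
rewrite (bigD1 (1 : 'S_2)%g) //= (bigD1 (tperm 0 1 : 'S_2)) /=; last first.
  by apply/eqP => /permP/(_ 0); rewrite tpermL perm1.
rewrite big1 ?addr0 => [|g /andP[g1 gt]].
  by rewrite !enum_ordSl enum_ord0 /= !perm1 !permE.
case/negP: gt; apply/eqP/permP => i.
have n01 : g 0 != g 1 by rewrite (inj_eq perm_inj).
have n0 : g 0 != 0.
  apply: contra g1 => /eqP g0; apply/eqP/permP => k; rewrite perm1.
  by case: (ord2P k) => -> //; case: (ord2P (g 1)) n01 => ->; rewrite ?g0 ?eqxx.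
have E0 : g 0 = 1 by case: (ord2P (g 0)) n0 => ->.
have E1 : g 1 = 0 by case: (ord2P (g 1)) n01 => ->; rewrite ?E0 ?eqxx.
by case: (ord2P i) => ->; rewrite ?tpermL ?tpermR.
Qed.

(** The sum over the permutations g of phi (t (g k)) does not depend on k;
    summed over all k, each g contributes the sum of phi over the entries of t.
    This counts the permutations with a prescribed first value without
    enumerating them. *)
Lemma symmetrize_head (I : eqType) (F : seq I -> R[i]) v : (0 < size v)%N ->
  (forall b s s', perm_eq s s' -> perm_eq (b :: s) v -> F (b :: s) = F (b :: s')) ->
  (size v)%:R * symmetrize F v = \sum_(x <- v) F (x :: rem x v).
Proof.
move=> v0 Fs; pose n := (size v).-1.
have sz : size v == n.+1 by rewrite prednK.
pose t := Tuple sz; rewrite -[v]/(tval t).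
pose phi x := F (x :: rem x t).
have Fphi g : F (permute t g) = phi (tnth t (g ord0)).
  have pt := permute_perm_eq t g.
  have E : val (permute t g) = tnth t (g ord0) :: behead (permute t g).
    by rewrite {1}(tuple_eta (permute t g)) /= /thead tnth_mktuple.
  rewrite E in pt *; apply: Fs => //; rewrite -(perm_cons (tnth t (g ord0))).
  by rewrite (perm_trans pt) // perm_to_rem // mem_tnth.
(* Moving the position k to the front is a bijection of the permutations. *)
have sumk k : \sum_(g : 'S_n.+1) phi (tnth t (g ord0)) =
    \sum_(g : 'S_n.+1) phi (tnth t (g k)).
  rewrite (reindex (fun g : 'S_n.+1 => (tperm ord0 k * g)%g)).
    by apply: eq_bigr => g _; rewrite permM tpermL.
  by exists (fun g : 'S_n.+1 => (tperm ord0 k * g)%g) => g _; rewrite mulgA tperm2 mul1g.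
have sumn : n.+1%:R * (\sum_(g : 'S_n.+1) phi (tnth t (g ord0)))
    = (n.+1)`!%:R * \sum_(x <- t) phi x.
  transitivity (\sum_(k < n.+1) \sum_(g : 'S_n.+1) phi (tnth t (g k))).
    under [RHS]eq_bigr do rewrite -sumk.
    by rewrite sumr_const card_ord mulr_natl.
  rewrite exchange_big /=.
  under eq_bigr => g _ do rewrite -(reindex_inj (h := g) (P := xpredT)
     (F := fun k => phi (tnth t k)) (@perm_inj _ g)).
  by rewrite sumr_const card_Sn -[LHS]mulr_natl (big_tuple _ _ t).
rewrite symmetrizeE size_tuple; under eq_bigr do rewrite Fphi.
by rewrite mulrCA sumn mulKf // fact_neq0.
Qed.

(** A permutation of the positions also permutes the terms of the derivation,
    since the same matrix acts at each of them. *)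
Lemma symmetrize_lie_act r (W : 'M[R[i]]_r) (F : seq 'I_r -> R[i]) v :
  symmetrize (lie_act W F) v = lie_act W (symmetrize F) v.
Proof.
pose upd n (t : n.-tuple 'I_r) (i : 'I_n) b : n.-tuple 'I_r :=
  [tuple if j == i then b else tnth t j | j < n].
have lie_actE n (t : n.-tuple 'I_r) T :
    lie_act W T t = \sum_(i < n) \sum_b W b (tnth t i) * T (upd n t i b).
  case: t => s sz; have E := eqP sz; subst n; apply: eq_bigr => i _.
  apply: eq_bigr => b _; congr (W _ _ * T _).
    by rewrite !(tnth_nth b).
  have szu : size (upd _ (Tuple sz) i b) = size s := size_tuple _.
  apply: (@eq_from_nth _ b); first by rewrite szu size_set_nth; apply/maxn_idPr.
  move=> j; rewrite size_set_nth (maxn_idPr _) // => jlt.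
  have -> : nth b (upd _ (Tuple sz) i b) j = tnth (upd _ (Tuple sz) i b) (Ordinal jlt).
    by rewrite (tnth_nth b).
  by rewrite tnth_mktuple nth_set_nth /= (tnth_nth b).
rewrite -[v]/(tval (in_tuple v)) symmetrizeE lie_actE.
under [RHS]eq_bigr => i _ do under eq_bigr => b _ do
  rewrite symmetrizeE mulrCA mulr_sumr.
have sum_lie_act g : lie_act W F (permute (in_tuple v) g) = \sum_i \sum_b
    W b (tnth (in_tuple v) i) * F (permute (upd _ (in_tuple v) i b) g).
  rewrite lie_actE (reindex_inj (@perm_inj _ g^-1%g)); apply: eq_bigr => i _.
  apply: eq_bigr => b _; rewrite tnth_mktuple permKV; congr (_ * F (tval _)).
  apply: eq_from_tnth => j; rewrite !tnth_mktuple.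
  by rewrite -(inj_eq (@perm_inj _ g)) permKV.
rewrite (eq_bigr _ (fun g _ => sum_lie_act g)) exchange_big mulr_sumr.
apply: eq_bigr => i _; rewrite exchange_big mulr_sumr.
by apply: eq_bigr => b _; rewrite mulr_sumr.
Qed.

End Symmetrize.

(** * Covariant derivatives of tensors with lower indices *)

Section CovariantCalculus.
Variables (R : realType) (n r : nat).
Implicit Types (D : set 'rV[R]_n) (x : 'rV[R]_n) (t : seq 'I_r -> 'rV[R]_n -> R[i]).
Implicit Types (w : 'I_n -> 'rV[R]_n -> 'M[R[i]]_r) (v s : seq 'I_r).

(** The covariant derivative, in the direction of the k-th coordinate, of a
    section of a tensor power of the dual of the bundle with connection form w,
    in components. *)
Definition cov w t (k : 'I_n) v x : R[i] :=
  pdC k (t v) x - lie_act (w k x) (t^~ x) v.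

Definition pdC_mx (k : 'I_n) (W : 'rV[R]_n -> 'M[R[i]]_r) x : 'M[R[i]]_r :=
  \matrix_(i, j) pdC k (fun y => W y i j) x.

Lemma pdCB (f g : 'rV[R]_n -> R[i]) x k : differentiableC f x -> differentiableC g x ->
  pdC k (fun y => f y - g y) x = pdC k f x - pdC k g x.
Proof.
move=> df dg; have dN1 := differentiableC_cst (-1) x.
have -> : (fun y => f y - g y) = (fun y => f y + -1 * g y).
  by apply/funext => y; rewrite mulN1r.
rewrite pdCD //; last exact: differentiableCM.
by rewrite pdCZ // mulN1r.
Qed.

Lemma differentiableC_lie_act (W : 'rV[R]_n -> 'M[R[i]]_r) t v x :
  (forall i j, differentiableC (fun y => W y i j) x) ->
  (forall s, size s = size v -> differentiableC (t s) x) ->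
  differentiableC (fun y => lie_act (W y) (t^~ y) v) x.
Proof.
move=> dW dt; apply: differentiableC_sum => i; apply: differentiableC_sum => b.
apply: differentiableCM => //; apply: dt.
by rewrite size_set_nth; apply/maxn_idPr.
Qed.

Lemma pdC_lie_act (W : 'rV[R]_n -> 'M[R[i]]_r) t v x k :
  (forall i j, differentiableC (fun y => W y i j) x) ->
  (forall s, size s = size v -> differentiableC (t s) x) ->
  pdC k (fun y => lie_act (W y) (t^~ y) v) x =
  lie_act (pdC_mx k W x) (t^~ x) v + lie_act (W x) (fun s => pdC k (t s) x) v.
Proof.
move=> dW dt.
have dM (i : 'I_(size v)) b : differentiableC (fun y =>
    W y b (tnth (in_tuple v) i) * t (set_nth b v i b) y) x.
  apply: differentiableCM => //; apply: dt.
  by rewrite size_set_nth; apply/maxn_idPr.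
rewrite /lie_act pdC_sum; last by move=> i; exact: differentiableC_sum.
rewrite -big_split; apply: eq_bigr => i _; rewrite pdC_sum //.
rewrite -big_split; apply: eq_bigr => b _; rewrite pdCM //; last first.
  by apply: dt; rewrite size_set_nth; apply/maxn_idPr.
by rewrite mxE.
Qed.

Lemma smoothC_lie_act D (W : 'rV[R]_n -> 'M[R[i]]_r) t v : open D ->
  (forall i j, smoothC D (fun y => W y i j)) ->
  (forall s, size s = size v -> smoothC D (t s)) ->
  smoothC D (fun y => lie_act (W y) (t^~ y) v).
Proof.
move=> oD dW dt; apply: smoothC_sum => // i; apply: smoothC_sum => // b.
apply: smoothCM => //; apply: dt.
by rewrite size_set_nth; apply/maxn_idPr.
Qed.

Lemma smoothCB D (f g : 'rV[R]_n -> R[i]) : open D -> smoothC D f -> smoothC D g ->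
  smoothC D (fun y => f y - g y).
Proof.
move=> oD sf sg; have -> : (fun y => f y - g y) = (fun y => f y + -1 * g y).
  by apply/funext => y; rewrite mulN1r.
by apply: smoothCD => //; apply: smoothCM => //; exact: smoothC_cst.
Qed.

Lemma smoothC_cov D w t k v : open D ->
  (forall i j, smoothC D (fun y => w k y i j)) ->
  (forall s, size s = size v -> smoothC D (t s)) ->
  smoothC D (cov w t k v).
Proof.
move=> oD sw st; apply: smoothCB => //; first by apply: smoothC_pdC; exact: st.
exact: smoothC_lie_act.
Qed.

(** The two orders of differentiation differ by the action of the curvature:
    partial derivatives commute, the terms with one derivative of t match, and
    the terms without one assemble to the curvature by [lie_act_comm]. *)
Lemma cov_comm D w t v x k l : open D -> D x ->
  (forall k i j, smoothC D (fun y => w k y i j)) ->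
  (forall s, size s = size v -> smoothC D (t s)) ->
  pdC_mx k (w l) x - pdC_mx l (w k) x + w k x *m w l x - w l x *m w k x = 0 ->
  cov w (cov w t k) l v x = cov w (cov w t l) k v x.
Proof.
move=> oD Dx sw st flat.
have dw k' i j : differentiableC (fun y => w k' y i j) x.
  exact: smoothC_differentiable (sw _ _ _) Dx.
have dt s : size s = size v -> differentiableC (t s) x.
  by move=> /st sts; exact: smoothC_differentiable sts Dx.
have dpt s k' : size s = size v -> differentiableC (pdC k' (t s)) x.
  by move=> /st sts; apply: smoothC_differentiable (smoothC_pdC _ sts) Dx.
have E k' l' : cov w (cov w t k') l' v x = pdC l' (pdC k' (t v)) x
   - lie_act (w k' x) (fun s => pdC l' (t s) x) v
   - lie_act (w l' x) (fun s => pdC k' (t s) x) v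
   - lie_act (pdC_mx l' (w k') x) (t^~ x) v + lie_act (w l' x) (lie_act (w k' x) (t^~ x)) v.
  rewrite {1}/cov pdCB; [|exact: dpt|exact: differentiableC_lie_act].
  by rewrite pdC_lie_act // /cov lie_actB opprB opprD; move: (lie_act _ _ v) (lie_act _ _ v)
     (lie_act _ _ v) (lie_act _ _ v) (pdC _ _ _) => *; ring.
rewrite !E (pdC_pdC_comm k l oD Dx (st _ erefl)).
have C := lie_act_comm (w l x) (w k x) (t^~ x) v; rewrite lie_actBm in C.
have {flat} : lie_act (pdC_mx k (w l) x - pdC_mx l (w k) x
    - (w l x *m w k x - w k x *m w l x)) (t^~ x) v = 0.
  by rewrite opprB addrA flat lie_act0m.
rewrite !lie_actBm; move: C.
move: (lie_act _ _ v) (lie_act _ _ v) (lie_act _ _ v) (lie_act _ _ v) (lie_act _ _ v) (lie_act _ _ v)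
  (lie_act _ _ v) (lie_act _ _ v) (pdC _ _ _) => a b c d e f g h p C1 C2.
have -> : h = f - e + g by rewrite -C1 subrK.
have -> : c = d - (e - f) by rewrite -(subr0_eq C2); ring.
ring.
Qed.

Lemma pdC_symmetrize t v x k : (forall s, size s = size v -> differentiableC (t s) x) ->
  pdC k (fun y => symmetrize (t^~ y) v) x = symmetrize (fun s => pdC k (t s) x) v.
Proof.
move=> dt; have dt' (g : 'S_(size v)) :
    differentiableC (t [seq tnth (in_tuple v) (g i) | i <- enum 'I_(size v)]) x.
  by apply: dt; rewrite size_map size_enum_ord.
rewrite /symmetrize pdCZ; last exact: differentiableC_sum.
by rewrite pdC_sum.
Qed.

(** Symmetrization is a combination of permutations of the indices with
    constant coefficients, and so is parallel for every connection. *)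
Lemma symmetrize_cov w t v x k : (forall s, size s = size v -> differentiableC (t s) x) ->
  symmetrize (fun s => cov w t k s x) v = cov w (fun s y => symmetrize (t^~ y) s) k v x.
Proof. by move=> dt; rewrite symmetrizeB symmetrize_lie_act /cov pdC_symmetrize. Qed.

Lemma differentiableC_gauge_act (g : 'rV[R]_n -> 'M[R[i]]_r) t v x :
  (forall i j, differentiableC (fun y => g y i j) x) ->
  (forall s, size s = size v -> differentiableC (t s) x) ->
  differentiableC (fun y => gauge_act (g y) (t^~ y) v) x.
Proof.
move=> dg; elim: v t => [|c v IH] t dt /=; first exact: dt.
apply: differentiableC_sum => b; apply: differentiableCM => //.
by apply: (IH (fun s => t (b :: s))) => s sv; apply: dt; rewrite /= sv.
Qed.

(** The last hypothesis says that w' is the connection form w k x in the frame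
    changed by g, so that covariant differentiation commutes with changes of
    frame.  In the induction, the derivative of the factor of g at the first
    index is what turns w' into w k x there. *)
Lemma cov_gauge_act w (w' : 'M[R[i]]_r) (g : 'rV[R]_n -> 'M[R[i]]_r) t v x k :
  (forall i j, differentiableC (fun y => g y i j) x) ->
  (forall s, size s = size v -> differentiableC (t s) x) ->
  g x *m w' = w k x *m g x + pdC_mx k g x ->
  pdC k (fun y => gauge_act (g y) (t^~ y) v) x - lie_act w' (gauge_act (g x) (t^~ x)) v
  = gauge_act (g x) (fun s => cov w t k s x) v.
Proof.
move=> dg + gw; elim: v t => [|c v IH] t dt /=; first by rewrite /cov !lie_act_nil.
have dtb b s : size s = size v -> differentiableC (t (b :: s)) x.
  by move=> sv; apply: dt; rewrite /= sv.
have da b : differentiableC (fun y => gauge_act (g y) (fun s => t (b :: s) y) v) x.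
  by apply: (differentiableC_gauge_act dg (t := fun s => t (b :: s))) => s /dtb.
rewrite pdC_sum; last by move=> b; exact: differentiableCM.
have dE b : pdC k (fun y => g y b c * gauge_act (g y) (fun s => t (b :: s) y) v) x =
    pdC k (fun y => g y b c) x * gauge_act (g x) (fun s => t (b :: s) x) v
    + g x b c * (gauge_act (g x) (fun s => cov w (fun s' => t (b :: s')) k s x) v
        + lie_act w' (gauge_act (g x) (fun s => t (b :: s) x)) v).
  by rewrite (pdCM k (dg b c) (da b)) -(IH (fun s => t (b :: s)) (dtb b)) subrK.
(* The connection term at the first index, split off from the others. *)
have covE b s : cov w t k (b :: s) x = cov w (fun s' => t (b :: s')) k s x
    - \sum_b' w k x b' b * t (b' :: s) x.
  by rewrite /cov lie_act_cons opprD addrCA addrC.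
have aE b : gauge_act (g x) (fun s => cov w t k (b :: s) x) v =
    gauge_act (g x) (fun s => cov w (fun s' => t (b :: s')) k s x) v
    - \sum_b' w k x b' b * gauge_act (g x) (fun s => t (b' :: s) x) v.
  by rewrite -gauge_act_sum -gauge_actB; apply: eq_gauge_act => s _; rewrite covE.
rewrite (eq_bigr _ (fun b _ => dE b)) (eq_bigr _ (fun b _ => congr1 _ (aE b))).
have rE : lie_act w' (gauge_act (g x) (t^~ x)) (c :: v) =
    \sum_b (g x *m w') b c * gauge_act (g x) (fun s => t (b :: s) x) v
    + \sum_b g x b c * lie_act w' (gauge_act (g x) (fun s => t (b :: s) x)) v.
  rewrite lie_act_cons; congr (_ + _); last by rewrite -lie_act_sum.
  under [RHS]eq_bigr do rewrite mxE mulr_suml.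
  rewrite exchange_big /=; apply: eq_bigr => b _; rewrite mulr_sumr.
  by apply: eq_bigr => b' _; rewrite mulrA [w' _ _ * _]mulrC.
have sE : \sum_b g x b c * (\sum_b' w k x b' b * gauge_act (g x) (fun s => t (b' :: s) x) v)
    = \sum_b (w k x *m g x) b c * gauge_act (g x) (fun s => t (b :: s) x) v.
  under eq_bigr do rewrite mulr_sumr.
  rewrite exchange_big /=; apply: eq_bigr => b _; rewrite mxE mulr_suml.
  by apply: eq_bigr => b' _; rewrite mulrA [g x _ _ * _]mulrC.
rewrite rE gw; under [X in _ = X]eq_bigr do rewrite mulrBr.
rewrite sumrB sE.
under eq_bigr do rewrite mulrDr; rewrite !big_split /=.
under [X in _ - (X + _)]eq_bigr do rewrite mxE mulrDl [pdC_mx _ _ _ _ _]mxE.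
rewrite big_split /=.
move: (\sum_b _) (\sum_b _) (\sum_b _) (\sum_b _) => s1 s2 s3 s4; ring.
Qed.

End CovariantCalculus.

Section CovariantCalculusOnOpenSets.
Variables (R : realType) (n r : nat).
Implicit Types (D : set 'rV[R]_n) (x : 'rV[R]_n) (t : seq 'I_r -> 'rV[R]_n -> R[i]).
Implicit Types (w : 'I_n -> 'rV[R]_n -> 'M[R[i]]_r) (v s : seq 'I_r).

Lemma eq_cov D w t t' k v x : open D -> D x ->
  (forall y s, D y -> size s = size v -> t s y = t' s y) ->
  cov w t k v x = cov w t' k v x.
Proof.
move=> oD Dx tt'; rewrite /cov; congr (_ - _).
  by apply: near_eq_pdC oD _ Dx => y Dy; exact: tt'.
by apply: eq_lie_act => s; exact: tt'.
Qed.

Lemma cov0 w k v x : cov w (fun _ _ => 0) k v x = 0.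
Proof.
rewrite /cov pdC_cst sub0r (eq_lie_act _ (t' := fun s => 0 * 0)).
  by rewrite lie_actZ mul0r oppr0.
by move=> s _; rewrite mul0r.
Qed.

(** The derivative of the vanishing tensor symmetrize t. *)
Lemma symmetrize_cov0 D w t k v x : open D -> D x ->
  (forall s, size s = size v -> smoothC D (t s)) ->
  (forall y s, D y -> size s = size v -> symmetrize (t^~ y) s = 0) ->
  symmetrize (fun s => cov w t k s x) v = 0.
Proof.
move=> oD Dx st t0.
rewrite symmetrize_cov; last by move=> s /st sts; exact: smoothC_differentiable sts Dx.
by rewrite (eq_cov (t' := fun _ _ => 0) w k oD Dx t0) cov0.
Qed.

(** A tensor is symmetric when it is its own symmetrization, and the latter
    commutes with the covariant derivative. *)
Lemma cov_perm D w t k s v x : open D -> D x ->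
  (forall s, size s = size v -> smoothC D (t s)) ->
  (forall y s s', D y -> size s = size v -> perm_eq s s' -> t s y = t s' y) ->
  perm_eq s v -> cov w t k s x = cov w t k v x.
Proof.
move=> oD Dx st tp sv.
have E u : size u = size v -> cov w t k u x = symmetrize (fun s => cov w t k s x) u.
  move=> uv; rewrite symmetrize_cov; last first.
    by move=> s' s'u; apply: smoothC_differentiable (st _ _) Dx; rewrite s'u.
  apply: eq_cov oD Dx _ => y s' Dy s's; apply/esym/symmetrize_id => s2 s2s.
  by apply: tp => //; rewrite (perm_size s2s) s's.
by rewrite !E // ?(perm_size sv) //; exact: symmetrize_perm.
Qed.

Lemma cov_sum D w (I : finType) (f : I -> R[i])
    (T : I -> seq 'I_r -> 'rV[R]_n -> R[i]) k v x : open D -> D x ->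
  (forall i, smoothC D (T i v)) ->
  cov w (fun s y => \sum_i f i * T i s y) k v x = \sum_i f i * cov w (T i) k v x.
Proof.
move=> oD Dx sT.
have dT i : differentiableC (T i v) x by exact: smoothC_differentiable (sT i) Dx.
rewrite /cov pdC_sum; last first.
  by move=> i; apply: differentiableCM => //; exact: differentiableC_cst.
rewrite lie_act_sum -sumrB; apply: eq_bigr => i _.
by rewrite pdCZ // mulrBr.
Qed.

End CovariantCalculusOnOpenSets.

(** * Two-component spinor algebra *)

Section SpinorAlgebra.
Variable R : realType.

Lemma symp_sqr r : symp R r *m symp R r = - 1%:M.
Proof.
rewrite /symp mulmx_block !mul0mx !mulmx0 !mul1mx !mulmx1 !addr0 !add0r.
by rewrite [in RHS](@scalar_mx_block _ r r) opp_block_mx !oppr0.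
Qed.

Lemma symp_tr r : (symp R r)^T = - symp R r.
Proof.
by rewrite /symp tr_block_mx !trmx0 linearN /= !trmx1 opp_block_mx !oppr0 opprK.
Qed.

Lemma sympN r (A B : 'I_(r + r)) : symp R r A B = - symp R r B A.
Proof. by have /matrixP/(_ B A) := symp_tr r; rewrite !mxE. Qed.

Lemma symp1E : (symp R 1 0 0 = 0) * (symp R 1 0 1 = 1) *
  (symp R 1 1 0 = -1) * (symp R 1 1 1 = 0).
Proof.
have e0 : (0 : 'I_(1 + 1)) = lshift 1 0 by exact: val_inj.
have e1 : (1 : 'I_(1 + 1)) = rshift 1 0 by exact: val_inj.
by rewrite /symp e0 e1 block_mxEul block_mxEur block_mxEdl block_mxEdr !mxE /=.
Qed.

Lemma sum_H (f : 'I_(1 + 1) -> R[i]) : \sum_b f b = f 0 + f 1.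
Proof. by rewrite !big_ord_recl big_ord0 addr0; congr (f _ + f _); exact: val_inj. Qed.

(** On a two-dimensional space every skew form is a multiple of eps; this
    writes the skew part of T in its first two indices as eps times a trace. *)
Lemma symp_contract (a b : Hidx) (T : Hidx -> Hidx -> R[i]) :
  symp R 1 a b * (\sum_c \sum_d symp R 1 c d * T d c) = T b a - T a b.
Proof.
rewrite !sum_H !symp1E.
case: (ord2P a) => ->; case: (ord2P b) => ->; rewrite !symp1E; ring.
Qed.

Lemma imagu_sqr : imagu R * imagu R = -1.
Proof. by rewrite /imagu mulcE; congr (_ +i* _); ring. Qed.

Lemma sum_pauli (G : 'M[R[i]]_(1 + 1) -> R[i]) : \sum_k G (pauli R k) =
  G (\matrix_(i, j) (if i == j then 0 else 1)) +
  (G (\matrix_(i, j) (if i == j then 0 else if i == 0 then - imagu R else imagu R)) +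
   G (\matrix_(i, j) (if i == j then (if i == 0 then 1 else -1) else 0))).
Proof. by rewrite !big_ord_recl big_ord0 addr0. Qed.

(** The completeness relation of the Pauli matrices,
    sum_k (sigma_k)^a_b (sigma_k)^c_d = 2 delta^a_d delta^c_b - delta^a_b delta^c_d,
    with the indices lowered as in the definition of [omega_dd]. *)
Lemma pauli_completeness (a b c d : Hidx) :
  \sum_e 2^-1 * (\sum_k pauli R k e b *
     \sum_f (- imagu R * pauli R k f d) * symp R 1 c f) * symp R 1 e a
  = imagu R / 2 * (symp R 1 c a * symp R 1 b d + symp R 1 c b * symp R 1 a d).
Proof.
pose G e (s : 'M[R[i]]_(1 + 1)) := s e b * \sum_f (- imagu R * s f d) * symp R 1 c f.
transitivity (\sum_e 2^-1 * (\sum_k G e (pauli R k)) * symp R 1 e a) => //.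
rewrite sum_H !sum_pauli /G !sum_H; move: (symp R 1) symp1E => eps epsE; rewrite !mxE.
move: (imagu R) imagu_sqr => I II.
case: (ord2P a) => ->; case: (ord2P b) => ->; case: (ord2P c) => ->;
  case: (ord2P d) => ->; rewrite !epsE /=.
all: by rewrite ?(mulNr, mulrN) ?II; ring.
Qed.

(** The trace eps^{bc} D_{cb...}. *)
Definition contract (D : seq Hidx -> R[i]) (w : seq Hidx) : R[i] :=
  \sum_b \sum_c symp R 1 b c * D (c :: b :: w).

(** H (x) S^(n+1) H is the sum of S^(n+2) H and S^n H, and a tensor without
    component in the first summand is eps times its trace, symmetrized.  For the
    constant: by [symp_contract] the right-hand side is the symmetrization over
    h :: w = v of D_{h b w} - D_{b h w}, where the second term is D_{b v}; the
    vanishing of the symmetrization of D over b :: v makes the first one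
    average to - D_{b v} / (n + 1), by [symmetrize_head]. *)
Lemma spinor_reconstruct (D : seq Hidx -> R[i]) n b v : size v = n.+1 ->
  (forall c s s', perm_eq s s' -> size s = n.+1 -> D (c :: s) = D (c :: s')) ->
  (forall s, size s = n.+2 -> symmetrize D s = 0) ->
  D (b :: v) = - (n.+1%:R / n.+2%:R) *
    symmetrize (fun s => symp R 1 b (head ord0 s) * contract D (behead s)) v.
Proof.
move=> vn Dperm Dsym.
pose G (s : seq Hidx) := D (head ord0 s :: b :: behead s).
rewrite (eq_symmetrize (F' := fun s => G s - D (b :: v))); last first.
  move=> [|h w] pv; first by move: (perm_size pv); rewrite vn.
  rewrite (symp_contract b h (fun c d => D [:: c, d & w])); congr (_ - _).
  by apply: (Dperm _ _ _ pv); rewrite (perm_size pv).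
rewrite symmetrizeB (symmetrize_id (F := fun=> D (b :: v))) //.
have G0 : n.+1%:R * symmetrize G v = - D (b :: v).
  rewrite -{1}vn symmetrize_head ?vn //; last first.
    move=> h s s' ss' /perm_size /= hs; apply: Dperm; first by rewrite perm_cons.
    by rewrite /= hs.
  have Dh h s s' : perm_eq s s' -> perm_eq (h :: s) (b :: v) ->
      D (h :: s) = D (h :: s').
    by move=> ss' /perm_size /= [hs]; apply: Dperm ss' _; rewrite hs.
  have := symmetrize_head (F := D) (v := b :: v) isT Dh.
  rewrite Dsym /= ?vn // mulr0 big_cons /= eqxx => /esym/eqP.
  rewrite addr_eq0 => /eqP ->; rewrite opprK.
  apply: eq_big_seq => h hv; rewrite /G /=; apply: Dperm.
    case: eqP => [->|_]; last by [].
    by rewrite perm_sym perm_to_rem.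
  by rewrite /= size_rem // vn.
have n1 : n.+1%:R != 0 :> R[i] by rewrite pnatr_eq0.
have n2 : n.+2%:R != 0 :> R[i] by rewrite pnatr_eq0.
have -> : symmetrize G v = n.+1%:R^-1 * - D (b :: v) by rewrite -G0 mulKf.
rewrite -[n.+2%:R]natr1 in n2 *.
by move: n.+1%:R (D _) n1 n2 => p d p0 p1; field; rewrite p0 p1.
Qed.

End SpinorAlgebra.

Section Symplectic.
Variable R : realType.

(** The form eps identifies the standard representation with its dual. *)
Lemma in_sp_dual r (W : 'M[R[i]]_(r + r)) : in_sp W ->
  symp R r *m W^T = - (W *m symp R r).
Proof.
move=> [/eqP WE _]; move: WE; rewrite addr_eq0 => /eqP WE.
have -> : symp R r *m W^T = - (symp R r *m (W^T *m symp R r) *m symp R r).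
  by rewrite -!mulmxA symp_sqr !mulmxN mulmx1 opprK.
by rewrite WE mulmxN mulNmx opprK mulmxA symp_sqr mulNmx mul1mx mulNmx.
Qed.

Lemma in_Sp_dual r (g : 'M[R[i]]_(r + r)) : in_Sp g ->
  symp R r *m g^T = invmx g *m symp R r.
Proof.
move=> [gE _].
have gl : - (symp R r *m g^T *m symp R r) *m g = 1%:M.
  by rewrite mulNmx -!mulmxA [g^T *m _]mulmxA gE symp_sqr opprK.
have [_ gu] := mulmx1_unit gl.
have gi : invmx g = - (symp R r *m g^T *m symp R r).
  by rewrite -[RHS]mulmx1 -(mulmxV gu) mulmxA gl mul1mx.
by rewrite gi mulNmx -(mulmxA _ (symp R r) (symp R r)) symp_sqr mulmxN mulmx1 opprK.
Qed.

Lemma sum_mulmx p q r (U : 'M[R[i]]_(p, q)) (V : 'M[R[i]]_(q, r)) (f : 'I_r -> R[i]) A :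
  \sum_i U A i * (\sum_j V i j * f j) = \sum_j (U *m V) A j * f j.
Proof.
under eq_bigr do rewrite mulr_sumr.
rewrite exchange_big; apply: eq_bigr => j _; rewrite mxE mulr_suml.
by apply: eq_bigr => i _; rewrite mulrA.
Qed.

Lemma contractE (T : seq Hidx -> R[i]) v : contract T v = T [:: 1, 0 & v] - T [:: 0, 1 & v].
Proof. by rewrite /contract !sum_H !symp1E; ring. Qed.

(** sp(1) is contained in sl(2). *)
Lemma in_sp1_trace (W : 'M[R[i]]_(1 + 1)) : in_sp W -> W 0 0 = - W 1 1.
Proof.
move=> [/matrixP/(_ 0 1)]; rewrite !mxE.
under eq_bigr do rewrite mxE.
rewrite !sum_H !symp1E !(mulr0, mulr1, mul0r, mul1r, add0r, addr0) => /eqP.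
by rewrite addr_eq0 => /eqP.
Qed.

(** Sp(1) is contained in SL(2). *)
Lemma in_Sp1_det (g : 'M[R[i]]_(1 + 1)) : in_Sp g ->
  g 0 0 * g 1 1 - g 1 0 * g 0 1 = 1.
Proof.
move=> [/matrixP/(_ 0 1)]; rewrite mxE symp1E sum_H.
rewrite [fun_of_matrix (_ *m _) _ 0]mxE [fun_of_matrix (_ *m _) _ 1]mxE !sum_H.
rewrite [_^T _ 0]mxE [_^T _ 1]mxE !symp1E => <- _; ring.
Qed.

(** The form eps on H is parallel: the connection acts on the two contracted
    indices through its trace, which is zero. *)
Lemma cov_contract n (w : 'I_n -> 'rV[R]_n -> 'M[R[i]]_(1 + 1)) t k v x :
  (forall s, size s = (size v).+2 -> differentiableC (t s) x) ->
  in_sp (w k x) ->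
  cov w (fun s y => contract (t^~ y) s) k v x = contract (fun s => cov w t k s x) v.
Proof.
move=> dt wsp; rewrite contractE /cov !lie_act_cons !sum_H (in_sp1_trace wsp).
have dt2 b c : differentiableC (t [:: c, b & v]) x by exact: dt.
rewrite (_ : (fun y => contract (t^~ y) v) = fun y => t [:: 1, 0 & v] y - t [:: 0, 1 & v] y);
  last by apply/funext => y; rewrite contractE.
rewrite pdCB //.
rewrite (eq_lie_act _ (t' := fun s => t [:: 1, 0 & s] x - t [:: 0, 1 & s] x));
  last by move=> s _; rewrite contractE.
rewrite lie_actB; move: (lie_act _ _ v) (lie_act _ _ v) (pdC _ _ _) (pdC _ _ _) => *; ring.
Qed.

(** A change of frame acts on the two contracted indices through its
    determinant, which is one. *)
Lemma gauge_act_contract (g : 'M[R[i]]_(1 + 1)) (T : seq Hidx -> R[i]) v : in_Sp g ->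
  contract (gauge_act g T) v = gauge_act g (contract T) v.
Proof.
move=> /in_Sp1_det gdet; rewrite contractE /= !sum_H.
rewrite [RHS](eq_gauge_act _ (t' := fun s => T [:: 1, 0 & s] - T [:: 0, 1 & s]));
  last by move=> s _; rewrite contractE.
rewrite gauge_actB.
move: (gauge_act _ _ v) (gauge_act _ _ v) (gauge_act _ _ v) (gauge_act _ _ v) => a b c d.
by rewrite -[RHS]mul1r -gdet; ring.
Qed.

End Symplectic.

(** * The hyperkaehler geometry in a chart *)

Section Geometry.
Variables (R : realType) (m : nat) (M : smooth_manifold R (4 * m)).
Variables (K : hyperkahler M) (S : spinor_splitting K).
Implicit Types (a : chart_index M) (x : 'rV[R]_(4 * m)) (s v : seq Hidx).

Local Notation wE a := (conn (bundleE S) a).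
Local Notation wH a := (conn (bundleH S) a).
Local Notation chr a := (christoffel (metric K a)).
Local Notation gE := (gauge (bundleE S)).
Local Notation gH := (gauge (bundleH S)).

Lemma open_chart_im a : open (chart_im a). Proof. exact: chart_im_open. Qed.
Local Hint Resolve open_chart_im : core.

Lemma nabla_coordE (T : components M) a k v x :
  nabla_coord S T a k [::] v x = cov (wH a) (fun s => T a [::] s) k v x.
Proof. by rewrite /nabla_coord big_ord0 addr0. Qed.

(** The Levi-Civita connection is torsion-free. *)
Lemma christoffel_sym a x k i j : chart_im a x -> chr a k i j x = chr a k j i x.
Proof.
move=> Dx; rewrite /christoffel; congr (_ * _); apply: eq_bigr => l _.
congr (_ * _); rewrite [pd i _ x + _]addrC; congr (_ - _).
apply: near_eq_pd; apply: (@open_near_eq _ _ (chart_im a)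
  (fun y => metric K a y i j) (fun y => metric K a y j i)) => // y Dy.
by have /matrixP/(_ j i) := Defs.metric_sym K Dy; rewrite mxE.
Qed.

Lemma kahler_formE a k A p B b x : chart_im a x ->
  kahler_form S a k A p B b x =
  symp R m A B * \sum_f (- imagu R * pauli R k f b) * symp R 1 p f.
Proof.
move=> Dx; rewrite /kahler_form vielbein_cplx // mulmx_sumr summxE mulr_sumr.
apply: eq_bigr => f _.
by rewrite -scalemxAr mxE vielbein_metric // mulrCA.
Qed.

(** The formula i eps_{A'(C'} eps_{D')B'} eps_{AB} for the Kaehler forms. *)
Lemma omega_ddE a c d A p B b x : chart_im a x ->
  omega_dd S a c d A p B b x = symp R m A B * (imagu R / 2 *
    (symp R 1 p c * symp R 1 d b + symp R 1 p d * symp R 1 c b)).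
Proof.
move=> Dx; rewrite -pauli_completeness mulr_sumr; apply: eq_bigr => e _.
rewrite mulrA; congr (_ * _); rewrite mulrCA; congr (_ * _).
rewrite mulr_sumr; apply: eq_bigr => k _.
by rewrite kahler_formE // mulrCA.
Qed.

Lemma overlap_open a b : open (overlap a b).
Proof.
rewrite openE => x [Dx bx].
have c := chart_inv_continuous Dx (open_nbhs_nbhs (conj (chart_dom_open b) bx)).
exact: filterI (open_nbhs_nbhs (conj (@open_chart_im a) Dx)) c.
Qed.

Lemma transition_chart_im a b x : overlap a b x -> chart_im b (transition a b x).
Proof. by move=> [_ bx]; exists (chart_inv a x). Qed.

Lemma transition_differentiable a b x : overlap a b x ->
  differentiable (transition a b) x.
Proof.
move=> ox; apply: differentiable_rV => i.
by have [d _] := chart_smooth a b i 1%N; exact: d.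
Qed.

(** * First and second derivatives of a Killing tensor *)

Variables (mu : components M) (n : nat).
Hypothesis hmu : killing0 S n.+1 mu.
Local Notation X := (killing_potential_tensor S n.+1 mu).

(** The derivative nabla_{AA'} mu in the local frames, with A' as the head of
    the sequence: the Killing equation is then the vanishing of a
    symmetrization over the whole sequence. *)
Definition dmu a (A : Eidx m) s x : R[i] :=
  \sum_k vielbein S a A (head ord0 s) x k 0 *
    cov (wH a) (fun s => mu a [::] s) k (behead s) x.

(** The second derivative nabla_l nabla_k mu in coordinate directions. *)
Definition hessian a (l k : 'I_(4 * m)) s x : R[i] :=
  cov (wH a) (cov (wH a) (fun s => mu a [::] s) k) l s x
  - \sum_h (chr a h l k x)%:C * cov (wH a) (fun s => mu a [::] s) h s x.

(** The covariant derivative of [dmu] in the l-th coordinate direction.  Only the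
    first derivative is referred to the frames: [ddmu] then obeys in its primed
    indices the same linear equations as [dmu], for each l. *)
Definition ddmu a l (A : Eidx m) s x : R[i] :=
  \sum_k vielbein S a A (head ord0 s) x k 0 * hessian a l k (behead s) x.

Lemma mu_smooth a s : size s = n.+1 -> smoothC (chart_im a) (mu a [::] s).
Proof.
move=> sn; have [[/(_ a [tuple]) sm _] _ _] := hmu.
have sz : size s == n.+1 by apply/eqP.
exact: sm (Tuple sz).
Qed.

Lemma smooth_covmu a k s : size s = n.+1 ->
  smoothC (chart_im a) (cov (wH a) (fun s => mu a [::] s) k s).
Proof.
move=> sn; apply: smoothC_cov => //; first by move=> i j; exact: conn_smooth.
by move=> s' s's; apply: mu_smooth; rewrite s's.
Qed.

Lemma smooth_dmu a A s : size s = n.+2 -> smoothC (chart_im a) (dmu a A s).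
Proof.
case: s => [//|b s] [sn]; apply: smoothC_sum => // k.
apply: smoothCM => //; first exact: vielbein_smooth.
exact: smooth_covmu.
Qed.

Lemma mu_perm a x s s' : chart_im a x -> size s = n.+1 -> perm_eq s s' ->
  mu a [::] s x = mu a [::] s' x.
Proof.
move=> Dx sn ss'; have [_ sm _] := hmu.
have E u : size u = n.+1 -> mu a [::] u x = symmetrize (fun s => mu a [::] s x) u.
  move=> un; have sz : size u == n.+1 by apply/eqP.
  exact: (sm a [tuple] (Tuple sz) x Dx).
by rewrite !E // -?(perm_size ss') //; exact: symmetrize_perm.
Qed.

Lemma covmu_perm a k x s s' : chart_im a x -> size s = n.+1 -> perm_eq s s' ->
  cov (wH a) (fun s => mu a [::] s) k s x = cov (wH a) (fun s => mu a [::] s) k s' x.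
Proof.
move=> Dx sn ss'; have s'n : size s' = n.+1 by rewrite -(perm_size ss').
apply: (@cov_perm _ _ _ (chart_im a) (wH a) (fun s => mu a [::] s) k s s' x) => //.
  by move=> u us; apply: mu_smooth; rewrite us.
by move=> y u u' Dy us; apply: mu_perm => //; rewrite us.
Qed.

Lemma hessian_perm a l k x s s' : chart_im a x -> size s = n.+1 -> perm_eq s s' ->
  hessian a l k s x = hessian a l k s' x.
Proof.
move=> Dx sn ss'; have s'n : size s' = n.+1 by rewrite -(perm_size ss').
rewrite /hessian.
have -> : \sum_h (chr a h l k x)%:C * cov (wH a) (fun s => mu a [::] s) h s x =
  \sum_h (chr a h l k x)%:C * cov (wH a) (fun s => mu a [::] s) h s' x.
  by apply: eq_bigr => h _; rewrite (covmu_perm h Dx sn ss').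
apply: (congr2 (fun z w => z - w) _ erefl).
apply: (@cov_perm _ _ _ (chart_im a) (wH a)
    (cov (wH a) (fun s => mu a [::] s) k) l s s' x) => //.
  by move=> u us; apply: smooth_covmu; rewrite us.
by move=> y u u' Dy us; apply: covmu_perm => //; rewrite us.
Qed.

(** The curvature of H vanishes, and the Levi-Civita connection is torsion-free. *)
Lemma hessian_sym a l k x s : chart_im a x -> size s = n.+1 ->
  hessian a l k s x = hessian a k l s x.
Proof.
move=> Dx sn; rewrite /hessian.
under eq_bigr do rewrite christoffel_sym //.
apply: (congr2 (fun z w => z - w) _ erefl).
apply: (@cov_comm _ _ _ (chart_im a) (wH a) (fun s => mu a [::] s)) => //.
  by move=> *; exact: conn_smooth.
  by move=> u us; apply: mu_smooth; rewrite us.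
rewrite -[RHS](flatH S k l Dx); congr (_ + _ - _).
by apply/matrixP => i j; rewrite !mxE.
Qed.

Lemma nabla_ddE a A b v x : nabla_dd S mu a A b [::] v x = dmu a A (b :: v) x.
Proof. by apply: eq_bigr => k _; rewrite nabla_coordE. Qed.

Lemma dmu_perm a A b x s s' : chart_im a x -> size s = n.+1 -> perm_eq s s' ->
  dmu a A (b :: s) x = dmu a A (b :: s') x.
Proof.
by move=> Dx sn ss'; apply: eq_bigr => k _; rewrite (covmu_perm k Dx sn ss').
Qed.

Lemma ddmu_perm a l A b x s s' : chart_im a x -> size s = n.+1 -> perm_eq s s' ->
  ddmu a l A (b :: s) x = ddmu a l A (b :: s') x.
Proof.
by move=> Dx sn ss'; apply: eq_bigr => k _; rewrite (hessian_perm l k Dx sn ss').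
Qed.

Lemma dmu_symmetrize a A x s : chart_im a x -> size s = n.+2 ->
  symmetrize (fun s => dmu a A s x) s = 0.
Proof.
move=> Dx sn; have [_ _ km] := hmu.
have sz : size s == n.+2 by apply/eqP.
rewrite -[RHS](km a x A (Tuple sz) Dx); apply: eq_symmetrize => -[|b u] /perm_size us.
  by rewrite sn in us.
by rewrite nabla_ddE.
Qed.

(** The vielbein is parallel for the connections of TM, E and H together.  As
    [cov] only acts on the primed indices, the connection of E remains as an
    explicit term. *)
Lemma cov_dmu a l A b v x : chart_im a x -> size v = n.+1 ->
  cov (wH a) (dmu a A) l (b :: v) x =
  ddmu a l A (b :: v) x + \sum_B wE a l x B A * dmu a B (b :: v) x.
Proof.
move=> Dx vn; set N := cov (wH a) (fun s => mu a [::] s).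
have dN k s : size s = size v -> differentiableC (N k s) x.
  by rewrite vn => sn; exact: (smoothC_differentiable (smooth_covmu a k sn) Dx).
have de b' k : differentiableC (fun y => vielbein S a A b' y k 0) x.
  exact: (smoothC_differentiable (vielbein_smooth S a A b' k) Dx).
have E1 : pdC l (dmu a A (b :: v)) x = \sum_k
   (pdC l (fun y => vielbein S a A b y k 0) x * N k v x
    + vielbein S a A b x k 0 * pdC l (N k v) x).
  rewrite [LHS]pdC_sum; last first.
    by move=> k; exact: (differentiableCM (de b k) (dN k v erefl)).
  by apply: eq_bigr => k _; rewrite (pdCM l (de b k) (dN k v erefl)).
have E2 : lie_act (wH a l x) (fun s => dmu a A (b :: s) x) v =
    \sum_k vielbein S a A b x k 0 * lie_act (wH a l x) (N k ^~ x) v.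
  exact: (lie_act_sum (wH a l x) (index_enum _) (fun k => vielbein S a A b x k 0)
    (fun k s => N k s x) v).
have E3 k : pdC l (fun y => vielbein S a A b y k 0) x =
    \sum_B wE a l x B A * vielbein S a B b x k 0
    + \sum_c wH a l x c b * vielbein S a A c x k 0
    - \sum_h (chr a k l h x)%:C * vielbein S a A b x h 0.
  by rewrite -(vielbein_parallel S l A b k Dx) addrK.
pose s3 := \sum_k \sum_h (chr a k l h x)%:C * vielbein S a A b x h 0 * N k v x.
have E4 : \sum_k pdC l (fun y => vielbein S a A b y k 0) x * N k v x =
    \sum_B wE a l x B A * dmu a B (b :: v) x
    + \sum_c wH a l x c b * dmu a A (c :: v) x - s3.
  under eq_bigr => k _.
    rewrite E3 mulrBl mulrDl !mulr_suml.
    over.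
  rewrite sumrB big_split; congr (_ + _ - _); rewrite exchange_big;
    by apply: eq_bigr => B _; rewrite mulr_sumr; apply: eq_bigr => k _; rewrite mulrA.
have E5 : ddmu a l A (b :: v) x =
    \sum_k vielbein S a A b x k 0 * pdC l (N k v) x
    - \sum_k vielbein S a A b x k 0 * lie_act (wH a l x) (N k ^~ x) v - s3.
  rewrite /s3 exchange_big -!sumrB; apply: eq_bigr => k _.
  rewrite -mulrBr -[RHS]/(_ * (cov (wH a) (N k) l v x) - _) /hessian mulrBr.
  congr (_ - _); rewrite mulr_sumr; apply: eq_bigr => h _.
  by rewrite mulrCA mulrA.
rewrite {1}/cov lie_act_cons E1 E2 E5 big_split /= E4.
clear E1 E2 E3 E4 E5; move: s3 (\sum_B _) (\sum_c _) (\sum_k _) (\sum_k _) => s3 s1 s2 s4 s5; ring.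
Qed.

(** The derivative of the Killing equation. *)
Lemma ddmu_symmetrize a l A x s : chart_im a x -> size s = n.+2 ->
  symmetrize (fun s => ddmu a l A s x) s = 0.
Proof.
move=> Dx sn.
have E s' : perm_eq s' s -> ddmu a l A s' x =
    cov (wH a) (dmu a A) l s' x - \sum_B wE a l x B A * dmu a B s' x.
  move=> /perm_size; rewrite sn; case: s' => [//|b v] [vn].
  by rewrite (cov_dmu l A b Dx vn) addrK.
rewrite (eq_symmetrize E) symmetrizeB symmetrize_sum.
rewrite (@symmetrize_cov0 _ _ _ (chart_im a)) //; first last.
- by move=> y s' Dy s's; rewrite dmu_symmetrize // s's.
- by move=> s' s's; apply: smooth_dmu; rewrite s's.
rewrite big1 ?subrr // => B _.
by rewrite dmu_symmetrize // mulr0.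
Qed.

(** * The potential tensor and its covariant derivative *)

Definition potential_coef : R[i] := - imagu R * (n.+1%:R / n.+2%:R).

Lemma potentialE a A v x :
  X a [:: A] v x = potential_coef * \sum_B symp R m A B * contract (fun s => dmu a B s x) v.
Proof.
rewrite /killing_potential_tensor; congr (_ * _).
rewrite /contract; under [RHS]eq_bigr do rewrite mulr_sumr.
rewrite [RHS]exchange_big; apply: eq_bigr => b _.
under [RHS]eq_bigr do rewrite mulr_sumr.
rewrite [RHS]exchange_big; apply: eq_bigr => c _.
rewrite /nabla_ud mulr_sumr; apply: eq_bigr => B _.
by rewrite nabla_ddE mulrCA.
Qed.

Lemma smooth_contract_dmu a B v : size v = n ->
  smoothC (chart_im a) (fun x => contract (fun s => dmu a B s x) v).
Proof.
move=> vn; apply: smoothC_sum => // b; apply: smoothC_sum => // c.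
apply: smoothCM => //; first exact: smoothC_cst.
by apply: smooth_dmu; rewrite /= vn.
Qed.

Lemma smooth_potential a A v : size v = n -> smoothC (chart_im a) (X a [:: A] v).
Proof.
move=> vn; rewrite (_ : X a [:: A] v = fun x =>
    potential_coef * \sum_B symp R m A B * contract (fun s => dmu a B s x) v); last first.
  by apply/funext => x; exact: potentialE.
apply: smoothCM => //; first exact: smoothC_cst.
apply: smoothC_sum => // B; apply: smoothCM => //; first exact: smoothC_cst.
exact: smooth_contract_dmu.
Qed.

Lemma cov_contract_dmu a l B v x : chart_im a x -> size v = n ->
  cov (wH a) (fun s y => contract (fun s => dmu a B s y) s) l v x =
  contract (fun s => ddmu a l B s x) v
  + \sum_C wE a l x C B * contract (fun s => dmu a C s x) v.
Proof.
move=> Dx vn; rewrite cov_contract; first last.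
- exact: conn_sp.
- move=> s sv; apply: (smoothC_differentiable _ Dx); apply: smooth_dmu.
  by rewrite sv vn.
rewrite contractE !cov_dmu //=; last by rewrite vn. 2: by rewrite vn.
rewrite [in RHS]contractE; under [in RHS]eq_bigr do rewrite contractE mulrBr.
rewrite sumrB; move: (ddmu _ _ _ _ _) (ddmu _ _ _ _ _) => p1 p2.
move: (\sum_C _) (\sum_C _) => *; ring.
Qed.

(** Both symplectic forms are parallel, so that the derivative of the trace X
    of nabla mu is the same trace of nabla nabla mu. *)
Lemma nabla_potential a l A v x : chart_im a x -> size v = n ->
  nabla_coord S X a l [:: A] v x =
  potential_coef * \sum_B symp R m A B * contract (fun s => ddmu a l B s x) v.
Proof.
move=> Dx vn.
have -> : nabla_coord S X a l [:: A] v x = cov (wH a) (fun s => X a [:: A] s) l v x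
    + \sum_B wE a l x A B * X a [:: B] v x.
  by rewrite /nabla_coord big_ord1 /cov -addrA [in RHS]addrAC -addrA.
pose C B v y := contract (fun s => dmu a B s y) v.
have -> : cov (wH a) (fun s => X a [:: A] s) l v x =
    potential_coef * \sum_B symp R m A B * cov (wH a) (C B) l v x.
  have sC B : smoothC (chart_im a) (C B v) by exact: smooth_contract_dmu.
  rewrite -(cov_sum (wH a) _ l (@open_chart_im a) Dx sC).
  have dS : differentiableC (fun y => \sum_B symp R m A B * C B v y) x.
    apply: differentiableC_sum => B; apply: differentiableCM.
      exact: differentiableC_cst.
    exact: (smoothC_differentiable (sC B) Dx).
  rewrite /cov mulrBr -(pdCZ potential_coef l dS) -lie_actZ; congr (pdC l _ x - lie_act _ _ v).
    by apply/funext => y; rewrite potentialE.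
  by apply/funext => s; rewrite potentialE.
under eq_bigr do rewrite /C cov_contract_dmu // mulrDr.
under [X in _ + X]eq_bigr do rewrite potentialE mulrCA.
rewrite -mulr_sumr -mulrDr big_split -addrA; congr (_ * _).
rewrite -[RHS]addr0; congr (_ + _).
have trE B D : wE a l x D B = (wE a l x)^T B D by rewrite mxE.
under eq_bigr => B _ do under eq_bigr => D _ do rewrite trE.
rewrite !sum_mulmx in_sp_dual; last exact: conn_sp.
by rewrite -big_split big1 // => B _; rewrite /= mxE mulNr addNr.
Qed.

Lemma ddmu_reconstruct a l B b v x : chart_im a x -> size v = n.+1 ->
  ddmu a l B (b :: v) x = - (n.+1%:R / n.+2%:R) * symmetrize (fun s =>
    symp R 1 b (head ord0 s) * contract (fun s => ddmu a l B s x) (behead s)) v.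
Proof.
move=> Dx vn; apply: (spinor_reconstruct (D := fun s => ddmu a l B s x)) => //.
  by move=> c s s' ss' sn; exact: ddmu_perm.
by move=> s sn; exact: ddmu_symmetrize.
Qed.

Lemma dmu_reconstruct a B b v x : chart_im a x -> size v = n.+1 ->
  dmu a B (b :: v) x = - (n.+1%:R / n.+2%:R) * symmetrize (fun s =>
    symp R 1 b (head ord0 s) * contract (fun s => dmu a B s x) (behead s)) v.
Proof.
move=> Dx vn; apply: (spinor_reconstruct (D := fun s => dmu a B s x)) => //.
  by move=> c s s' ss' sn; exact: dmu_perm.
by move=> s sn; exact: dmu_symmetrize.
Qed.

Lemma potential_coefE : - imagu R * potential_coef = - (n.+1%:R / n.+2%:R).
Proof. by rewrite /potential_coef mulrA mulrNN imagu_sqr mulN1r. Qed.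

Lemma symmetrize_symp_sum (A : Eidx m) b (f : Eidx m -> seq Hidx -> R[i]) v :
  symmetrize (fun s => symp R 1 b (head ord0 s) *
     (potential_coef * \sum_B symp R m A B * f B (behead s))) v
  = potential_coef * \sum_B symp R m A B *
     symmetrize (fun s => symp R 1 b (head ord0 s) * f B (behead s)) v.
Proof.
rewrite -symmetrize_sum -symmetrizeZ; apply: eq_symmetrize => s _.
rewrite mulrCA; congr (_ * _); rewrite mulr_sumr.
by apply: eq_bigr => B _; rewrite mulrCA.
Qed.

(** The Killing equation leaves only the trace part X of nabla mu; the factor
    -i times [potential_coef] is the constant of [spinor_reconstruct]. *)
Lemma nabla_ud_mu a A b v x : chart_im a x -> size v = n.+1 ->
  nabla_ud S mu a A b [::] v x = - imagu R * symmetrize (fun s =>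
    symp R 1 b (head ord0 s) * X a [:: A] (behead s) x) v.
Proof.
move=> Dx vn.
under [in RHS]eq_fun do rewrite potentialE.
rewrite (symmetrize_symp_sum A b (fun B w => contract (fun s => dmu a B s x) w)).
rewrite mulrA potential_coefE mulr_sumr; apply: eq_bigr => B _.
by rewrite nabla_ddE dmu_reconstruct // mulrCA.
Qed.

(** nabla^C_c nabla^A_b mu_v. *)
Definition ddmu_uu a C c A b v x : R[i] :=
  \sum_D symp R m C D * \sum_l vielbein S a D c x l 0 *
    \sum_B symp R m A B * ddmu a l B (b :: v) x.

(** The derivative of [nabla_ud_mu], obtained by applying [spinor_reconstruct]
    to nabla nabla mu rather than by differentiating that formula. *)
Lemma ddmu_uuE a C c A b v x : chart_im a x -> size v = n.+1 ->
  ddmu_uu a C c A b v x = - imagu R * symmetrize (fun s =>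
    symp R 1 b (head ord0 s) * nabla_ud S X a C c [:: A] (behead s) x) v.
Proof.
move=> Dx vn.
have E l : \sum_B symp R m A B * ddmu a l B (b :: v) x = - imagu R *
    symmetrize (fun s => symp R 1 b (head ord0 s) *
       nabla_coord S X a l [:: A] (behead s) x) v.
  rewrite (eq_symmetrize (F' := fun s => symp R 1 b (head ord0 s) *
     (potential_coef * \sum_B symp R m A B * contract (fun s => ddmu a l B s x) (behead s)))).
    rewrite (symmetrize_symp_sum A b (fun B w => contract (fun s => ddmu a l B s x) w)).
    rewrite mulrA potential_coefE mulr_sumr; apply: eq_bigr => B _.
    by rewrite ddmu_reconstruct // mulrCA.
  move=> s /perm_size sv; rewrite nabla_potential //.
  by rewrite size_behead sv vn.
rewrite /ddmu_uu; under eq_bigr => D _ do under eq_bigr => l _ do rewrite E mulrCA.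
under eq_bigr => D _ do rewrite -mulr_sumr mulrCA -symmetrize_sum.
rewrite -mulr_sumr -symmetrize_sum; congr (_ * _); apply: eq_symmetrize => s _.
rewrite mulr_sumr; apply: eq_bigr => D _; rewrite mulrCA; congr (_ * _).
by rewrite mulr_sumr; apply: eq_bigr => l _; rewrite mulrCA.
Qed.

(** The hessian is symmetric in its two coordinate directions, each of which
    carries one pair of an E-index and an H-index. *)
Lemma ddmu_uu_sym a C c A b v x : chart_im a x -> size v = n.+1 ->
  ddmu_uu a C c A b v x = ddmu_uu a A b C c v x.
Proof.
move=> Dx vn.
have E C' p A' b' : ddmu_uu a C' p A' b' v x =
    \sum_D \sum_B \sum_l \sum_k symp R m C' D * symp R m A' B *
      vielbein S a D p x l 0 * vielbein S a B b' x k 0 * hessian a l k v x.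
  apply: eq_bigr => D _.
  rewrite mulr_sumr; under eq_bigr do rewrite mulrA mulr_sumr.
  rewrite exchange_big; apply: eq_bigr => B _; apply: eq_bigr => l _.
  rewrite /ddmu mulrA mulr_sumr; apply: eq_bigr => k _.
  by rewrite !mulrA; congr (_ * _ * _); rewrite -!mulrA; congr (_ * _); rewrite mulrC.
rewrite !E [RHS]exchange_big; apply: eq_bigr => D _; apply: eq_bigr => B _.
rewrite [RHS]exchange_big; apply: eq_bigr => l _; apply: eq_bigr => k _.
rewrite (hessian_sym l k Dx vn) [symp R m A _ * _]mulrC.
by congr (_ * _); rewrite -!mulrA; congr (_ * (_ * _)); rewrite mulrC.
Qed.

(** * The Killing and tri-Hamiltonian equations *)

(** The trace of nabla^C_c nabla^D_b mu over c and b is skew in C and D, because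
    the exchange of both pairs of indices is a symmetry and eps is skew.  By
    [ddmu_uuE] this trace is, up to a factor, the symmetrization of
    nabla^C_{A'} X^D over all the primed indices. *)
Lemma nabla_potential_skew a A B v x : chart_im a x -> size v = n.+1 ->
  symmetrize (fun s => nabla_ud S X a A (head ord0 s) [:: B] (behead s) x) v
  = - symmetrize (fun s => nabla_ud S X a B (head ord0 s) [:: A] (behead s) x) v.
Proof.
move=> Dx vn.
have E C D : symmetrize (fun s => nabla_ud S X a C (head ord0 s) [:: D] (behead s) x) v
    = - imagu R * (ddmu_uu a C 0 D 1 v x - ddmu_uu a C 1 D 0 v x).
  rewrite !ddmu_uuE // -mulrBr mulrA mulrNN imagu_sqr mulN1r -symmetrizeB.
  rewrite -mulN1r -symmetrizeZ; apply: eq_symmetrize => -[|h w] _ /=.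
    by rewrite (_ : ord0 = 0) ?symp1E; [ring|exact: val_inj].
  by case: (ord2P h) => ->; rewrite !symp1E; ring.
rewrite !E [ddmu_uu a B 0 A 1 _ _]ddmu_uu_sym //.
by rewrite [ddmu_uu a B 1 A 0 _ _]ddmu_uu_sym //; ring.
Qed.

(** Dually, the trace of nabla^C_b nabla^A_c mu over C and A is skew in b and
    c, and the explicit form of omega makes the tri-Hamiltonian expression a
    multiple of its symmetric part. *)
Lemma triham_potential a b c v x : chart_im a x -> size v = n.+1 ->
  symmetrize (fun s => \sum_C \sum_d \sum_A omega_dd S a b c C d A (head ord0 s) x *
     nabla_uu S X a C d [:: A] (behead s) x) v = 0.
Proof.
move=> Dx vn.
have E (C A : Eidx m) s : \sum_d omega_dd S a b c C d A (head ord0 s) x *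
     nabla_uu S X a C d [:: A] (behead s) x =
   symp R m C A * (imagu R / 2 *
     (symp R 1 c (head ord0 s) * nabla_ud S X a C b [:: A] (behead s) x +
      symp R 1 b (head ord0 s) * nabla_ud S X a C c [:: A] (behead s) x)).
  rewrite /nabla_uu sum_H !sum_H !omega_ddE //.
  move: (nabla_ud S X a C) => f.
  by case: (ord2P b) => ->; case: (ord2P c) => ->; rewrite !symp1E; ring.
rewrite (eq_symmetrize (F' := fun s => \sum_C 1 * \sum_A symp R m C A * (imagu R / 2 *
     (symp R 1 c (head ord0 s) * nabla_ud S X a C b [:: A] (behead s) x +
      symp R 1 b (head ord0 s) * nabla_ud S X a C c [:: A] (behead s) x)))); last first.
  move=> s _; apply: eq_bigr => C _; rewrite mul1r exchange_big.
  by apply: eq_bigr => A _; rewrite E.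
rewrite symmetrize_sum.
(* T is symmetric in b and c, hence in C and A. *)
pose T (C A : Eidx m) := ddmu_uu a C b A c v x + ddmu_uu a C c A b v x.
have TE C : symmetrize (fun s => \sum_A symp R m C A * (imagu R / 2 *
     (symp R 1 c (head ord0 s) * nabla_ud S X a C b [:: A] (behead s) x +
      symp R 1 b (head ord0 s) * nabla_ud S X a C c [:: A] (behead s) x))) v
    = \sum_A symp R m C A * (- 2^-1 * T C A).
  rewrite symmetrize_sum; apply: eq_bigr => A _; congr (_ * _).
  rewrite symmetrizeZ symmetrizeD /T !ddmu_uuE //.
  by move: (symmetrize _ v) (symmetrize _ v) => y z; ring.
under eq_bigr do rewrite TE mul1r.
set t := \sum_C _; have tN : t = - t.
  rewrite {1}/t exchange_big -sumrN; apply: eq_bigr => C _.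
  rewrite -sumrN; apply: eq_bigr => A _; rewrite sympN mulNr; congr (- (_ * (_ * _))).
  by rewrite /T (ddmu_uu_sym A b) // (ddmu_uu_sym A c) // addrC.
by apply/eqP; move/eqP: tN; rewrite -subr_eq0 opprK -mulr2n mulrn_eq0.
Qed.

Lemma potential_perm a A x s s' : chart_im a x -> size s = n -> perm_eq s s' ->
  X a [:: A] s x = X a [:: A] s' x.
Proof.
move=> Dx sn ss'; rewrite !potentialE; congr (_ * _); apply: eq_bigr => B _.
congr (_ * _); rewrite !contractE; congr (_ - _);
  by apply: dmu_perm => //=; rewrite ?sn ?perm_cons.
Qed.

(** * The transformation law of the potential tensor *)

Lemma mu_gauge a b v x : overlap a b x -> size v = n.+1 ->
  mu b [::] v (transition a b x) = gauge_act (gH a b x) (fun s => mu a [::] s x) v.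
Proof.
move=> ox vn; have sz : size v == n.+1 by apply/eqP.
have [[_ law] _ _] := hmu; have := law a b [tuple] (Tuple sz) x ox.
move=> /= ->; rewrite (big_pred1 [tuple]) => [|w]; last by rewrite [w]tuple0 /= eqxx.
rewrite -[RHS](gauge_act_tuple (gH a b x) (fun s => mu a [::] s x) (Tuple sz)).
by apply: eq_bigr => w _; rewrite big_ord0 mul1r.
Qed.

(** The covariance of the derivative of mu: the connection form of H pulled back
    along the transition map is the one over the first chart in another frame,
    as [cov_gauge_act] requires. *)
Lemma covmu_gauge a b k v x : overlap a b x -> size v = n.+1 ->
  \sum_l ('J (transition a b) x k l)%:C *
    cov (wH b) (fun s => mu b [::] s) l v (transition a b x)
  = gauge_act (gH a b x) (fun s => cov (wH a) (fun s => mu a [::] s) k s x) v.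
Proof.
move=> ox vn; have [Dx _] := ox; have Dy := transition_chart_im ox.
set t := transition a b; set J := 'J t x.
pose w' := \sum_l (J k l)%:C *: wH b l (t x).
have dmua s : size s = size v -> differentiableC (mu a [::] s) x.
  by rewrite vn => sn; exact: (smoothC_differentiable (mu_smooth a sn) Dx).
have dg i j : differentiableC (fun y => gH a b y i j) x.
  exact: (smoothC_differentiable (gauge_smooth _ a b i j) ox).
rewrite -(cov_gauge_act (w' := w') dg dmua); last exact: conn_gauge.
have -> : pdC k (fun y => gauge_act (gH a b y) (fun s => mu a [::] s y) v) x =
    \sum_l (J k l)%:C * pdC l (mu b [::] v) (t x).
  have law y : overlap a b y ->
      gauge_act (gH a b y) (fun s => mu a [::] s y) v = mu b [::] v (t y).
    by move=> oy; rewrite (mu_gauge oy vn).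
  rewrite (near_eq_pdC k (@overlap_open a b) law ox).
  apply: pdC_comp; first exact: transition_differentiable.
  exact: (smoothC_differentiable (mu_smooth b vn) Dy).
have rw T : lie_act w' T v = \sum_l (J k l)%:C * lie_act (wH b l (t x)) T v.
  rewrite /lie_act; under [RHS]eq_bigr do rewrite mulr_sumr.
  rewrite [RHS]exchange_big; apply: eq_bigr => i _.
  under [RHS]eq_bigr do rewrite mulr_sumr.
  rewrite [RHS]exchange_big; apply: eq_bigr => c _.
  rewrite summxE mulr_suml; apply: eq_bigr => l _.
  by rewrite mxE mulrA.
rewrite (eq_lie_act w' (t' := fun s => mu b [::] s (t x))); last first.
  by move=> s sv; rewrite (mu_gauge ox) // sv.
by rewrite rw -sumrB; apply: eq_bigr => l _; rewrite -mulrBr.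
Qed.

Lemma dmu_gauge a b B v x : overlap a b x -> size v = n.+2 ->
  dmu b B v (transition a b x) =
  \sum_A gE a b x A B * gauge_act (gH a b x) (fun s => dmu a A s x) v.
Proof.
case: v => [//|c v] ox [vn].
rewrite /dmu /=.
have E l : vielbein S b B c (transition a b x) l 0 = \sum_A gE a b x A B *
    \sum_d gH a b x d c * \sum_k ('J (transition a b) x k l)%:C * vielbein S a A d x k 0.
  rewrite vielbein_gauge // summxE; apply: eq_bigr => A _.
  rewrite summxE mulr_sumr; apply: eq_bigr => d _.
  rewrite mxE -mulrA; congr (_ * (_ * _)); rewrite mxE; apply: eq_bigr => k _.
  by rewrite !mxE.
under eq_bigr => l _ do rewrite E mulr_suml.
rewrite exchange_big; apply: eq_bigr => A _.
under eq_bigr do rewrite -mulrA mulr_suml.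
rewrite -mulr_sumr; congr (_ * _).
rewrite exchange_big; apply: eq_bigr => d _.
under eq_bigr do rewrite -mulrA mulr_suml.
rewrite -mulr_sumr; congr (_ * _).
rewrite gauge_act_sum exchange_big; apply: eq_bigr => k _.
rewrite -(covmu_gauge k ox vn) mulr_sumr; apply: eq_bigr => l _.
by rewrite -mulrA mulrCA.
Qed.

(** The trace over the primed indices is invariant, and raising the E-index
    turns the change of frame of E into its inverse. *)
Lemma potential_gauge a b A v x : overlap a b x -> size v = n ->
  X b [:: A] v (transition a b x) =
  \sum_D invmx (gE a b x) A D * gauge_act (gH a b x) (fun s => X a [:: D] s x) v.
Proof.
move=> ox vn; rewrite potentialE.
pose C D := gauge_act (gH a b x) (contract (fun s => dmu a D s x)) v.
have E B : contract (fun s => dmu b B s (transition a b x)) v =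
    \sum_D gE a b x D B * C D.
  rewrite contractE !dmu_gauge //= ?vn //.
  rewrite -sumrB; apply: eq_bigr => D _; rewrite -mulrBr; congr (_ * _).
  by rewrite /C -gauge_act_contract ?contractE //; exact: gauge_Sp.
have trE B D : gE a b x D B = (gE a b x)^T B D by rewrite mxE.
under eq_bigr do rewrite E.
under eq_bigr => B _ do under eq_bigr => D _ do rewrite trE.
rewrite sum_mulmx in_Sp_dual; last exact: gauge_Sp.
rewrite -sum_mulmx mulr_sumr; apply: eq_bigr => D _.
rewrite mulrCA; congr (_ * _).
rewrite (eq_gauge_act _ (t' := fun s => potential_coef * \sum_B symp R m D B *
    contract (fun s => dmu a B s x) s)); last by move=> s _; rewrite potentialE.
by rewrite gauge_actZ gauge_act_sum.
Qed.

Lemma potential_is_tensor : is_tensor S 1 n X.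
Proof.
split=> [a u v|a b u v x ox].
  case/tupleP: u => A u; rewrite (tuple0 u) /=.
  by apply: smooth_potential; rewrite ?size_tuple.
case/tupleP: u => A u; rewrite (tuple0 u).
rewrite -[LHS]/(X b [:: A] v (transition a b x)) potential_gauge ?size_tuple //.
rewrite big_tuple_cons; apply: eq_bigr => D _.
rewrite (big_pred1 [tuple]) => [|w]; last by rewrite [w]tuple0 /= eqxx.
rewrite -(gauge_act_tuple (gH a b x) (fun s => X a [:: D] s x) v) mulr_sumr.
by apply: eq_bigr => w _; rewrite big_ord1 mulrA.
Qed.

Lemma potential_primed_symmetric : primed_symmetric 1 n X.
Proof.
move=> a u v x Dx; case/tupleP: u => A u; rewrite (tuple0 u) /=.
apply/esym/symmetrize_id => s sv; apply: potential_perm => //.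
by rewrite (perm_size sv) size_tuple.
Qed.

Lemma potential_killing : killing1 S n X.
Proof.
split; [exact: potential_is_tensor|exact: potential_primed_symmetric|].
move=> a x A B v Dx; rewrite symmetrize_pair /=.
by rewrite (nabla_potential_skew A B Dx) ?size_tuple // addNr mulr0.
Qed.

End Geometry.

Theorem proposition19 (R : realType) (m : nat) (M : smooth_manifold R (4 * m))
    (hM : simply_connected R M) (K : hyperkahler M) (S : spinor_splitting K)
    (j : nat) (hj : (1 <= j)%N) (mu : components M)
    (hmu : killing0 S (2 * j) mu) :
  let X := killing_potential_tensor S (2 * j) mu in
  (forall (a : chart_index M) (x : 'rV[R]_(4 * m)) (A : Eidx m) (A' : Hidx)
      (v : (2 * j).-tuple Hidx), chart_im a x ->
    nabla_ud S mu a A A' [::] v x =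
    - imagu R * symmetrize (fun s =>
        symp R 1 A' (head ord0 s) * X a [:: A] (behead s) x) v) /\
  tri_hamiltonian_killing1 S (2 * j - 1) X.
Proof.
have jE : (2 * j = (2 * j - 1).+1)%N by rewrite subn1 prednK // muln_gt0.
move: (2 * j - 1)%N jE hmu => n ->{j hj} hmu X; split.
  by move=> a x A A' v Dx; rewrite (nabla_ud_mu hmu) ?size_tuple.
split; first exact: potential_killing.
by move=> a x A' B' v Dx; rewrite (triham_potential hmu) ?size_tuple.
Qed.
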